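(* Let $p\in\mathbb N$ and let $\mathcal P_p\subset\ell^\infty(\mathbb Z;\mathbb R)$ be the space of real $p$-periodic sequences (with the $\ell^\infty$ norm). There is a dense $G_\delta$-set $\mathcal S\subset\mathcal P_p$ such that for each $\alpha\in\mathcal S$ all gaps in the spectrum of the operator $H_\alpha$ are open.
   Context: For $\alpha=\{\alpha_k\}_{k\in\mathbb Z}\in\ell^\infty(\mathbb Z;\mathbb R)$, $H_\alpha$ is the operator in $L^2(\mathbb R)$ acting as $H_\alpha u=-u''$ (off $\mathbb Z$) on the domain of all $u\in\widehat H^2(\mathbb R\setminus\mathbb Z)$ (the Hilbert direct sum of $H^2(k,k+1)$, $k\in\mathbb Z$) with $$u(k^+)=u(k^-),\qquad u'(k^+)-u'(k^-)=\alpha_ku(k)\qquad( * )$$ for all $k\in\mathbb Z$. Let $\alpha$ be $p$-periodic, $\alpha^{(p)}=\{\alpha_0,\dots,\alpha_{p-1}\}\in\mathbb R^p$, $I_p=(-1/2,p-1/2)$. For $\vartheta\in[0,2\pi)$ let $H_{\alpha^{(p)},\vartheta}$ be the operator $u\mapsto-u''$ in $L^2(I_p)$ on the domain of $u\in\widehat H^2(I_p\setminus\mathbb Z)$ (direct sum of $H^2$ over the component intervals of $I_p\setminus\mathbb Z$) satisfying $( * )$ for $k\in I_p\cap\mathbb Z$ and $u(-1/2^+)=e^{\mathbf i\vartheta}u((p-1/2)^-)$, $u'(-1/2^+)=e^{\mathbf i\vartheta}u'((p-1/2)^-)$. Let $\lambda_j(\alpha^{(p)},\vartheta)$, $j=1,2,\dots$,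 be its eigenvalues in non-decreasing order with multiplicity. Then $\mathrm{Spec}(H_\alpha)=[\lambda_1(\alpha^{(p)},0),\lambda_1(\alpha^{(p)},\pi)]\cup[\lambda_2(\alpha^{(p)},\pi),\lambda_2(\alpha^{(p)},0)]\cup[\lambda_3(\alpha^{(p)},0),\lambda_3(\alpha^{(p)},\pi)]\cup\dots$; these intervals are the bands. The gaps are the intervals $(\lambda_1(\alpha^{(p)},\pi),\lambda_2(\alpha^{(p)},\pi))$, $(\lambda_2(\alpha^{(p)},0),\lambda_3(\alpha^{(p)},0))$, $\dots$ between consecutive bands; a gap is open if the endpoints of the two adjacent bands do not coincide (the interval is nonempty), and closed otherwise. *)

(* Defs.v *)
From HB Require Import structures.
From mathcomp Require Import all_boot all_order all_algebra.
From mathcomp Require Import complex.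
From mathcomp Require Import all_classical all_reals all_analysis.

Set Implicit Arguments.
Unset Strict Implicit.
Unset Printing Implicit Defensive.

Import Order.TTheory GRing.Theory Num.Theory.
Import numFieldNormedType.Exports.

Local Open Scope classical_set_scope.
Local Open Scope ring_scope.

HB.instance Definition _ (R : rcfType) := NormedModule.copy R[i] R[i]^o.

Section PeriodicSequences.
Variables (R : realType) (p : nat).

(* Boundedness is part of the predicate so that the sup norm is a norm also
   for [p = 0]; for [0 < p] it follows from periodicity. *)
Definition periodic_linf : {pred int -> R} := fun a =>
  `[< has_ubound (range (fun k => `|a k|)) /\
      forall k : int, a (k + p%:Z) = a k >].

Lemma periodic_linf_submod_closed : submod_closed periodic_linf.
Proof.
split=> [|c a b /asboolP[[M aM] pa] /asboolP[[N bN] pb]]; apply/asboolP; split=> //.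
- by exists 0 => _ [k _ <-]; rewrite normr0.
- exists (`|c| * M + N) => _ [k _ <-].
  rewrite (le_trans (ler_normD _ _))// lerD//; last by apply: bN; exists k.
  by rewrite normrM ler_wpM2l//; apply: aM; exists k.
- by move=> k; rewrite !fctE/= pa pb.
Qed.

HB.instance Definition _ := GRing.isSubmodClosed.Build R (int -> R)
  periodic_linf periodic_linf_submod_closed.

Record periodic_seq := PeriodicSeq {
  seq_val :> int -> R;
  seq_valP : seq_val \in periodic_linf
}.

HB.instance Definition _ := [isSub for seq_val].
HB.instance Definition _ := [Choice of periodic_seq by <:].
HB.instance Definition _ := [SubChoice_isSubLmodule of periodic_seq by <:].

Definition linf_norm (a : periodic_seq) : R := sup (range (fun k => `|a k|)).

Lemma linf_norm_ub (a : periodic_seq) k : `|a k| <= linf_norm a.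
Proof. by case/asboolP: (seq_valP a) => ub _; apply: ub_le_sup => //; exists k. Qed.

Lemma linf_norm_le (a : periodic_seq) M :
  (forall k, `|a k| <= M) -> linf_norm a <= M.
Proof.
by move=> aM; apply: ge_sup; [exists (`|a 0|), 0 | move=> _ [k _ <-]].
Qed.

Lemma linf_normD a b : linf_norm (a + b) <= linf_norm a + linf_norm b.
Proof.
apply: linf_norm_le => k; rewrite (le_trans (ler_normD (a k) (b k)))//.
by rewrite lerD ?linf_norm_ub.
Qed.

Lemma linf_normZ (c : R) a : linf_norm (c *: a) = `|c| * linf_norm a.
Proof.
apply/eqP; rewrite eq_le; apply/andP; split.
  by apply: linf_norm_le => k; rewrite normrM ler_wpM2l// linf_norm_ub.
have [->|c0] := eqVneq c 0.
  by rewrite normr0 mul0r (le_trans _ (linf_norm_ub _ 0)).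
rewrite -ler_pdivlMl ?normr_gt0//; apply: linf_norm_le => k.
by rewrite ler_pdivlMl ?normr_gt0// -normrM; exact: (linf_norm_ub (c *: a) k).
Qed.

Lemma linf_norm_eq0 a : linf_norm a = 0 -> a = 0.
Proof.
move=> a0; apply/val_inj/funext => k; apply/eqP.
by rewrite -normr_le0 -a0; exact: linf_norm_ub.
Qed.

HB.instance Definition _ := @Lmodule_isNormed.Build R periodic_seq
  linf_norm linf_normD linf_normZ linf_norm_eq0.

End PeriodicSequences.

Section Operator.
Variable R : realType.
Local Notation C := (R[i]).
Local Notation mu := (@lebesgue_measure R).

Implicit Types (U D : set R) (u v w f : R -> C).

Definition L2 U u : Prop :=
  [/\ measurable_fun U (fun x => complex.Re (u x)),
      measurable_fun U (fun x => complex.Im (u x)) &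
      (\int[mu]_(x in U) ((complex.Re (u x)) ^+ 2 + (complex.Im (u x)) ^+ 2)%:E < +oo)%E].

Definition Cintegral U u : C :=
  Complex (Rintegral mu U (fun x => complex.Re (u x)))
          (Rintegral mu U (fun x => complex.Im (u x))).

(* [u] is locally absolutely continuous on the open set [U], with a.e.
   derivative [v]. *)
Definition primitive_on U u v : Prop :=
  forall x y, x <= y -> `[x, y] `<=` U -> u y - u x = Cintegral `[x, y] v.

(* [u] is (the representative that is C^1 on [U] of) an element of the Hilbert
   direct sum of the H^2(J), J ranging over the components of the open set [U],
   with first derivative [v] and second derivative [w]: every compact interval
   contained in [U] lies in a single component. *)
Definition H2hat U u v w : Prop :=
  [/\ L2 U u, L2 U v, L2 U w, primitive_on U u v & primitive_on U v w].

Definition cell (p : nat) : set R := `](- 2^-1), (p%:R - 2^-1)[.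

Definition Zset : set R := range (fun k : int => k%:~R).

Definition expi (theta : R) : C := Complex (cos theta) (sin theta).

(* Graph of the operator on the cell: [u] is in the domain and is mapped to the
   class of [f]. The one-sided limits exist for every [u] as in [H2hat]. *)
Definition qp_op (p : nat) (a : 'I_p -> R) (theta : R) u f : Prop :=
  exists v w,
    [/\ H2hat (cell p `\` Zset) u v w,
        forall k : 'I_p,
          lim (u x @[x --> k%:R^'+]) = lim (u x @[x --> k%:R^'-]) /\
          lim (v x @[x --> k%:R^'+]) - lim (v x @[x --> k%:R^'-]) =
            ((a k)%:C)%C * lim (u x @[x --> k%:R^'+]),
        lim (u x @[x --> (- 2^-1)^'+]) =
          expi theta * lim (u x @[x --> (p%:R - 2^-1)^'-]),
        lim (v x @[x --> (- 2^-1)^'+]) =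
          expi theta * lim (v x @[x --> (p%:R - 2^-1)^'-]) &
        ae_eq mu (cell p) f (fun x => - w x)].

Definition qp_eigenspace (p : nat) (a : 'I_p -> R) (theta z : R) : set (R -> C) :=
  [set u | qp_op a theta u (fun x => (z%:C)%C * u x)].

(* [n] is the complex dimension of [E] modulo equality a.e. on [D]. *)
Definition ae_dim D (E : set (R -> C)) (n : nat) : Prop :=
  exists e : 'I_n -> R -> C,
    [/\ forall i, E (e i),
        forall c : 'I_n -> C,
          ae_eq mu D (fun x => \sum_i c i * e i x) (cst 0) ->
          forall i, c i = 0 &
        forall u, E u -> exists c : 'I_n -> C,
          ae_eq mu D u (fun x => \sum_i c i * e i x)].

(* [l 0], [l 1], ... are the (real) eigenvalues in non-decreasing order, each
   repeated according to its multiplicity. *)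
Definition qp_eigenvalue_enum (p : nat) (a : 'I_p -> R) (theta : R)
    (l : nat -> R) : Prop :=
  {homo l : i j / (i <= j)%N >-> i <= j} /\
  forall (z : R) (n : nat), ae_dim (cell p) (qp_eigenspace a theta z) n <->
    ([set j | l j = z] #= `I_n)%card.

(* Indices start at 0: [qp_eigenvalue a theta j] is the (j+1)-st eigenvalue. The
   zero sequence is only a junk value for the case that the eigenvalues could
   not be enumerated. *)
Definition qp_eigenvalue (p : nat) (a : 'I_p -> R) (theta : R) : nat -> R :=
  xget (fun=> 0) [set l | qp_eigenvalue_enum a theta l].

Definition band_left (p : nat) (a : 'I_p -> R) (j : nat) : R :=
  qp_eigenvalue a (if odd j then pi else 0) j.

Definition band_right (p : nat) (a : 'I_p -> R) (j : nat) : R :=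
  qp_eigenvalue a (if odd j then 0 else pi) j.

Definition gap (p : nat) (a : 'I_p -> R) (j : nat) : set R :=
  `]band_right a j, band_left a j.+1[.

Definition one_period (p : nat) (alpha : periodic_seq R p) : 'I_p -> R :=
  fun k => alpha k%:Z.

Definition all_gaps_open (p : nat) (alpha : periodic_seq R p) : Prop :=
  forall j : nat, gap (one_period alpha) j !=set0.

End Operator.

(* Main.v *)
(** Between two integers a solution of -u'' = z u is propagated by a matrix built
    from cos (sqrt z) and sin (sqrt z) / sqrt z, and at the integer k it is hit by
    the shear with entry alpha_k. Hence the eigenspace for theta = 0 or pi at the
    energy z is the kernel of T(z) -+ 1, where T(z) is the 2 x 2 transfer matrix
    over one period, of determinant 1. A gap can only be closed when two consecutive
    eigenvalues for the same theta coincide, i.e. when T(z) = 1 or T(z) = -1 for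
    some z, so that no interlacing is needed: it suffices to take for S the set of
    alpha with T(z) <> 1 and T(z) <> -1 for all real z.

    S is a G_delta: for z in [-n, n] the condition is open by compactness. S is
    dense: if T(z) = 1 or -1, then the upper right entry of T(z) vanishes; it does
    not depend on alpha_{p-1} and has only simple zeros in z, hence countably many,
    and for each of them T(z) = 1 or -1 determines alpha_{p-1}.

    For alpha in S the eigenvalues can be enumerated: the Wronskian of a solution
    with its z-derivative is of one sign, so that tr T - 2 and tr T + 2 have simple
    zeros; tr T > 2 for z near -oo; and since |tr T| >= 2 wherever the upper right
    entry vanishes, both levels are reached for arbitrarily large z. *)

Require Import Defs.
From mathcomp Require Import all_boot all_order all_algebra.
From mathcomp Require Import complex.
From mathcomp Require Import all_classical all_reals all_analysis.
From mathcomp Require Import borel_hierarchy measurable_realfun.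
From mathcomp Require Import ring lra.

Import Order.TTheory GRing.Theory Num.Theory.
Import numFieldNormedType.Exports.
Local Open Scope classical_set_scope.
Local Open Scope ring_scope.

Set Implicit Arguments.
Unset Strict Implicit.
Unset Printing Implicit Defensive.

(** * The entire functions cos (sqrt y) and sin (sqrt y) / sqrt y *)

Section PowerSeries.
Variable R : realType.
Implicit Types (f : nat -> R) (x y z t : R).

(** Domination by the exponential series. The bound survives formal differentiation, so it yields
    convergence everywhere and termwise derivatives. *)
Definition fact_bounded f := forall n, `|f n| <= n`!%:R^-1.

Lemma fact_bounded_diffs f : fact_bounded f -> fact_bounded (pseries_diffs f).
Proof.
move=> fb n; rewrite /pseries_diffs normrM normr_nat.
rewrite -ler_pdivlMl ?ltr0n// (le_trans (fb _))// factS natrM invfM.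
by rewrite lexx.
Qed.

Lemma fact_bounded_cvg f x : fact_bounded f -> cvgn (pseries f x).
Proof.
move=> fb; apply: normed_cvg.
apply: series_le_cvg; last exact: (is_cvg_series_exp_coeff `|x|).
- by move=> n; rewrite normr_ge0.
- by move=> n; rewrite /exp_coeff/= divr_ge0// exprn_ge0.
- by move=> n; rewrite /exp_coeff/= normrM normrX mulrC ler_wpM2l ?exprn_ge0.
Qed.

Lemma is_derive_pseries f x : fact_bounded f ->
  is_derive x 1 (fun x => limn (pseries f x)) (limn (pseries (pseries_diffs f) x)).
Proof.
move=> fb; have fb1 := fact_bounded_diffs fb; have fb2 := fact_bounded_diffs fb1.
apply: (@pseries_snd_diffs _ _ (`|x| + 1)); try exact: fact_bounded_cvg.
by rewrite (ger0_norm (_ : 0 <= _ + 1)) ?addr_ge0// ltrDl.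
Qed.

Definition ccoef n : R := (-1) ^+ n / n.*2`!%:R.
Definition scoef n : R := (-1) ^+ n / n.*2.+1`!%:R.

Lemma ccoef_bounded : fact_bounded ccoef.
Proof.
move=> n; rewrite normrM normrX normrN1 expr1n mul1r ger0_norm ?invr_ge0//.
by rewrite lef_pV2 ?posrE ?ltr0n ?fact_gt0// ler_nat leq_fact// -addnn leq_addr.
Qed.

Lemma scoef_bounded : fact_bounded scoef.
Proof.
move=> n; rewrite normrM normrX normrN1 expr1n mul1r ger0_norm ?invr_ge0//.
rewrite lef_pV2 ?posrE ?ltr0n ?fact_gt0// ler_nat leq_fact// -addnn.
by rewrite -addnS leq_addr.
Qed.

(* [ccs y] is cos (sqrt y) and [scs y] is sin (sqrt y) / sqrt y; unlike these
   expressions the series make sense, and are smooth, across [y = 0]. *)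
Definition ccs y : R := limn (pseries ccoef y).
Definition scs y : R := limn (pseries scoef y).
Definition dscs y : R := limn (pseries (pseries_diffs scoef) y).

Lemma is_derive_scs y : is_derive y 1 scs (dscs y).
Proof. exact/is_derive_pseries/scoef_bounded. Qed.

Lemma ccoef_diffs n : pseries_diffs ccoef n = - 2^-1 * scoef n.
Proof.
rewrite /pseries_diffs /ccoef /scoef doubleS factS natrM invfM exprS.
have -> : n.*2.+2%:R = 2 * n.+1%:R :> R by rewrite -doubleS -mul2n natrM.
have : n.+1%:R != 0 :> R by rewrite pnatr_eq0.
have : n.*2.+1`!%:R != 0 :> R by rewrite pnatr_eq0 -lt0n fact_gt0.
by move: (n.+1%:R) (_`!%:R) => a b b0 a0; field; rewrite b0 a0.
Qed.

Lemma is_derive_ccs y : is_derive y 1 ccs (- 2^-1 * scs y).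
Proof.
have := is_derive_pseries y ccoef_bounded.
have -> : pseries (pseries_diffs ccoef) y = - 2^-1 *: pseries scoef y.
  apply/funext => n; rewrite /pseries /series/= !fctE/= scaler_sumr.
  by apply: eq_bigr => i _; rewrite ccoef_diffs -mulrA.
rewrite limZl_tmp//; exact/fact_bounded_cvg/scoef_bounded.
Qed.

(** Coefficientwise this is [ccoef n = (2 n + 1) scoef n]. It closes the differential system for
    [ccs] and [scs] without dividing by [y]. *)
Lemma dscsE y : 2 * y * dscs y = ccs y - scs y.
Proof.
have h := pseries_diffs_equiv (fact_bounded_cvg (x := y) (fact_bounded_diffs scoef_bounded)).
have hc := fact_bounded_cvg (x := y) ccoef_bounded.
have hs := fact_bounded_cvg (x := y) scoef_bounded.
have /(_ _) h2 := cvgZl_tmp (k := 2 * y) h.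
transitivity (2 * y *: dscs y); first by [].
rewrite -(cvg_lim (@norm_hausdorff _ _) h2); apply: cvg_lim => //.
suff -> : (2 * y) \*: (fun n => series (fun i => i%:R * scoef i * y ^+ i.-1) n) =
    pseries ccoef y - pseries scoef y.
  exact: cvgB.
apply/funext => n; rewrite /pseries /series /= !fctE/= scaler_sumr -sumrB.
apply: eq_bigr => -[|i] _; first by rewrite /= mul0r mul0r scaler0 /ccoef /scoef subrr.
have -> : ccoef i.+1 = i.+1.*2.+1%:R * scoef i.+1.
  rewrite /ccoef /scoef factS natrM invfM mulrCA mulVKf//.
rewrite -[i.+1.*2.+1%:R]natr1 -mul2n natrM /= exprS /GRing.scale/=; ring.
Qed.

Lemma pseries0 f : limn (pseries f 0) = f 0%N.
Proof.
apply: cvg_lim => //; apply/cvgrPdist_lt => e e0; near=> n.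
have n0 : (0 < n)%N by near: n; exists 1%N.
rewrite /pseries /series/= -(prednK n0) big_nat_recl// expr0 mulr1.
rewrite big1 ?addr0 ?subrr ?normr0// => i _.
by rewrite expr0n mulr0.
Unshelve. all: by end_near. Qed.

Lemma ccs0 : ccs 0 = 1.
Proof. by rewrite /ccs pseries0 /ccoef expr0 fact0 divr1. Qed.

Lemma scs0 : scs 0 = 1.
Proof. by rewrite /scs pseries0 /scoef expr0 divr1. Qed.

Lemma dscs0 : dscs 0 = - 6^-1.
Proof. by rewrite /dscs pseries0 /pseries_diffs /scoef mul1r expr1 mulN1r. Qed.

#[local] Existing Instance is_derive_scs.
#[local] Existing Instance is_derive_ccs.

(** By [dscsE] the derivative of the left side vanishes, and the value at 0 is 1. Negative [y],
    where the functions are hyperbolic, is covered as well. *)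
Lemma ccs2_scs2 y : ccs y ^+ 2 + y * scs y ^+ 2 = 1.
Proof.
rewrite -[RHS](_ : ccs 0 ^+ 2 + 0 * scs 0 ^+ 2 = 1); last first.
  by rewrite ccs0 mul0r addr0 expr1n.
apply: (@is_derive_0_is_cst _ (fun y => ccs y ^+ 2 + y * scs y ^+ 2)) => x.
apply: is_derive_eq; rewrite /GRing.scale/=.
have := dscsE x => h.
transitivity (scs x * (2 * x * dscs x - (ccs x - scs x))).
  by field.
by rewrite h subrr mulr0.
Qed.

Lemma cos_scs t : ccs (t ^+ 2) = cos t /\ t * scs (t ^+ 2) = sin t.
Proof.
(* Both pairs solve the same rotation system in [t], so their squared distance [F] is constant; it
   vanishes at 0. *)
pose F t := (ccs (t ^+ 2) - cos t) ^+ 2 + (t * scs (t ^+ 2) - sin t) ^+ 2.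
have F0 : F t = 0.
  transitivity (F 0); last first.
    by rewrite /F expr0n/= ccs0 cos0 sin0 mul0r !subrr !expr0n addr0.
  apply: is_derive_0_is_cst => x.
  have e1 : is_derive x (1 : R) (fun t : R => t ^+ 2) (2 * x).
    by apply: is_derive_eq; rewrite /GRing.scale/=; ring.
  have h1 : is_derive x (1 : R) (fun t : R => ccs (t ^+ 2)) (- (x * scs (x ^+ 2))).
    rewrite (_ : - _ = (- 2^-1 * scs (x ^+ 2)) * (2 * x)); last by field.
    exact: (@is_derive1_comp _ ccs (fun t => t ^+ 2)).
  have h2 : is_derive x (1 : R) (fun t : R => scs (t ^+ 2)) (dscs (x ^+ 2) * (2 * x)).
    exact: (@is_derive1_comp _ scs (fun t => t ^+ 2)).
  apply: is_derive_eq; rewrite /GRing.scale/=.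
  have h := dscsE (x ^+ 2).
  have {}h : x * (dscs (x ^+ 2) * (2 * x)) = ccs (x ^+ 2) - scs (x ^+ 2).
    by rewrite -h; ring.
  rewrite h; ring.
have /eqP := F0; rewrite paddr_eq0 ?sqr_ge0// !sqrf_eq0 !subr_eq0.
by case/andP => /eqP -> /eqP ->.
Qed.

(** With [t = sqrt y] this is [|sin t| < t]: clear for [t > 1], and otherwise the mean value theorem
    gives [sin t = t cos c] with [0 < c < t <= 1]. *)
Lemma sqr_scs_lt1 y : 0 < y -> scs y ^+ 2 < 1.
Proof.
move=> y0; set t := Num.sqrt y; have t0 : 0 < t by rewrite sqrtr_gt0.
have <- : t ^+ 2 = y by rewrite sqr_sqrtr// ltW.
have [_ h] := cos_scs t.
rewrite -(@ltr_pM2l _ (t ^+ 2)) ?exprn_gt0// -exprMn h mulr1.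
have [t1|t1] := ltP 1 t.
  apply: (@le_lt_trans _ _ 1); last by rewrite expr_gt1// ltW.
  by rewrite -(cos2Dsin2 t) lerDr sqr_ge0.
have [c /[!in_itv]/= /andP[c0 ct]] := @MVT _ sin cos 0 t t0
  (fun x _ => is_derive_sin x)
  (continuous_subspaceT (@continuous_sin R)).
rewrite sin0 !subr0 => ->; rewrite exprMn gtr_pMl ?exprn_gt0//.
rewrite cos2sin2 ltrBlDr ltrDl exprn_gt0// sin2_gt0// c0/=.
by rewrite (lt_le_trans ct)// (le_trans t1)// ler1n.
Qed.

(** At a negative argument all terms of both series are nonnegative, so the first two bound the sum
    from below. *)
Lemma ccs_scs_neg_ge y : 0 <= y ->
  1 + 2^-1 * y <= ccs (- y) /\ 1 + 6^-1 * y <= scs (- y).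
Proof.
move=> y0.
have bd f : fact_bounded f -> (forall n, 0 <= f n * (- y) ^+ n) ->
    f 0%N - f 1%N * y <= limn (pseries f (- y)).
  move=> fb f0.
  have ndp : nondecreasing_seq (pseries f (- y)).
    by apply: (@nondecreasing_series _ _ xpredT 0%N) => n _ _; exact: f0.
  have := nondecreasing_cvgn_le ndp (fact_bounded_cvg (x := - y) fb) 2%N.
  rewrite /pseries /series/= !big_nat_recl// big_geq// expr0 expr1 mulr1 addr0.
  by rewrite mulrN.
have sgn n : (-1) ^+ n * (- y) ^+ n = y ^+ n.
  by rewrite -exprMn mulrN mulN1r opprK.
split.
- have := bd _ ccoef_bounded; rewrite /ccoef fact0 expr0 expr1.
  rewrite divr1 !mulN1r mulNr opprK; apply => n.
  by rewrite mulrAC sgn divr_ge0 ?exprn_ge0.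
- have := bd _ scoef_bounded; rewrite /scoef expr0 expr1.
  rewrite divr1 !mulN1r mulNr opprK; apply => n.
  by rewrite mulrAC sgn divr_ge0 ?exprn_ge0.
Qed.
End PowerSeries.

(** * Transfer matrices and Sturm monotonicity *)

Section Transfer.
Variable R : realType.
Implicit Types (al x y z : R) (a : nat -> R) (X : R * R).

#[local] Existing Instance is_derive_scs.
#[local] Existing Instance is_derive_ccs.

(* Minus the Wronskian of a solution and its energy derivative grows over one
   unit interval by this form, which is the integral of the squared solution. *)
Lemma energy_form_gt0 z x y : (x, y) != (0, 0) ->
  0 < 2^-1 * (1 + ccs z * scs z) * x ^+ 2 + scs z ^+ 2 * x * y +
      (2^-1 * scs z ^+ 2 + ccs z * dscs z) * y ^+ 2.
Proof.
move=> xy0.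
have dE := dscsE z; have cE := ccs2_scs2 z.
set c := ccs z in dE cE *; set s := scs z in dE cE *; set d := dscs z in dE *.
(* Positivity of the coefficient of [x^2]: below 0 both [c] and [s] are positive, above 0 one has
   [c^2 <= 1] and [s^2 < 1]. *)
have cs_gt : 0 < 1 + c * s.
  have [z0|z0] := ltP z 0.
    have [] := @ccs_scs_neg_ge R (- z); first by rewrite oppr_ge0 ltW.
    rewrite opprK -/c -/s => c1 s1.
    have c0 : 0 < c by rewrite (lt_le_trans _ c1)//; lra.
    have s0 : 0 < s by rewrite (lt_le_trans _ s1)//; lra.
    by rewrite addr_gt0// mulr_gt0.
  have [z0'|z0'] := eqVneq z 0.
    by rewrite /c /s z0' ccs0 scs0 mulr1.
  have s1 : s ^+ 2 < 1 by apply: sqr_scs_lt1; rewrite lt_def z0'.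
  have zs : 0 <= z * s ^+ 2 by rewrite mulr_ge0// sqr_ge0.
  have : `|c * s| < 1.
    rewrite -(@ltr_pXn2r _ 2)// ?nnegrE// expr1n real_normK ?num_real//.
    rewrite exprMn; have := sqr_ge0 s; have := sqr_ge0 c; nra.
  by rewrite ltr_norml => /andP[]; lra.
(* This is [4 A B - s^4], with [A] and [B] the coefficients of [x^2] and [y^2]. Its product with [z]
   collapses to [1 - s^2], whose sign is known on either side of 0. *)
have disc : 0 < (1 + c * s) * (s ^+ 2 + 2 * c * d) - s ^+ 4.
  have zdisc : z * ((1 + c * s) * (s ^+ 2 + 2 * c * d) - s ^+ 4) = 1 - s ^+ 2.
    transitivity ((1 + c * s) * (z * s ^+ 2 + c * (2 * z * d))
                  - s ^+ 2 * (z * s ^+ 2)); first by ring.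
    rewrite dE (_ : z * s ^+ 2 = 1 - c ^+ 2); last by rewrite -cE; ring.
    ring.
  have [z0|z0|z0] := ltgtP z 0.
  - have [] := @ccs_scs_neg_ge R (- z); first by rewrite oppr_ge0 ltW.
    rewrite opprK -/c -/s => _ s1.
    rewrite -(nmulr_rlt0 _ z0) zdisc subr_lt0 expr_gt1//; lra.
  - by rewrite -(pmulr_rgt0 _ z0) zdisc subr_gt0 sqr_scs_lt1.
  - rewrite /c /s /d z0 ccs0 scs0 dscs0; lra.
set A := 2^-1 * _; set B := 2^-1 * _ + _.
have A0 : 0 < A by rewrite mulr_gt0.
have AB : 0 < 4 * A * B - s ^+ 4.
  rewrite (_ : 4 * A * B = (1 + c * s) * (s ^+ 2 + 2 * c * d))//.
  by rewrite /A /B; field.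
have A4 : 0 < 4 * A by rewrite mulr_gt0.
rewrite -(pmulr_rgt0 _ A4).
rewrite (_ : 4 * A * _ = (2 * A * x + s ^+ 2 * y) ^+ 2 + (4 * A * B - s ^+ 4) * y ^+ 2);
  last by ring.
have [y0|y0] := eqVneq y 0.
  rewrite y0 expr0n/= !mulr0 !addr0 exprn_even_gt0//= !mulf_neq0//.
    by rewrite gt_eqF.
  by apply: contraNneq xy0 => ->; rewrite y0.
by rewrite ltr_wpDl ?sqr_ge0// mulr_gt0// exprn_even_gt0.
Qed.

(* [X] holds the values of u and u' at the left end of a unit interval; [step]
   gives those just to the right of its right end, where the coupling is [al]. *)
Definition step al z X : R * R :=
  let y := ccs z * X.1 + scs z * X.2 in
  (y, - z * scs z * X.1 + ccs z * X.2 + al * y).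

(* State at [(k - 1)^+]; as the cell starts at [-1/2], the first piece is extended
   to the left down to [-1]. *)
Fixpoint sol a z X k : R * R :=
  if k is k'.+1 then step (a k') z (sol a z X k') else X.

Lemma sol_lin a z X k :
  (sol a z X k).1 = X.1 * (sol a z (1, 0) k).1 + X.2 * (sol a z (0, 1) k).1 /\
  (sol a z X k).2 = X.1 * (sol a z (1, 0) k).2 + X.2 * (sol a z (0, 1) k).2.
Proof.
elim: k => [|k [IH1 IH2]] /=; first by rewrite !mulr1 !mulr0 addr0 add0r.
by rewrite IH1 IH2; split; ring.
Qed.

Lemma sol_det a z k :
  (sol a z (1, 0) k).1 * (sol a z (0, 1) k).2 -
  (sol a z (1, 0) k).2 * (sol a z (0, 1) k).1 = 1.
Proof.
elim: k => [|k IH] /=; first by rewrite mulr0 mulr1 subr0.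
transitivity ((ccs z ^+ 2 + z * scs z ^+ 2) *
  ((sol a z (1, 0) k).1 * (sol a z (0, 1) k).2 -
   (sol a z (1, 0) k).2 * (sol a z (0, 1) k).1)); first by ring.
by rewrite ccs2_scs2 IH mulr1.
Qed.

Lemma sol_neq0 a z X k : X != (0, 0) -> sol a z X k != (0, 0).
Proof.
move=> X0; elim: k => //= k; apply: contraNneq; rewrite /step => -[] h1 h2.
move: h2; rewrite h1 mulr0 addr0 => h2.
have cE := ccs2_scs2 z.
apply/eqP; rewrite [sol _ _ _ _]surjective_pairing; congr pair.
- rewrite -[LHS]mul1r -cE.
  transitivity (ccs z * (ccs z * (sol a z X k).1 + scs z * (sol a z X k).2)
    - scs z * (- z * scs z * (sol a z X k).1 + ccs z * (sol a z X k).2)).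
    by ring.
  by rewrite h1 h2 !mulr0 subrr.
- rewrite -[LHS]mul1r -cE.
  transitivity (z * scs z * (ccs z * (sol a z X k).1 + scs z * (sol a z X k).2)
    + ccs z * (- z * scs z * (sol a z X k).1 + ccs z * (sol a z X k).2)).
    by ring.
  by rewrite h1 h2 !mulr0 addr0.
Qed.

(** Induction on [k]. The coupling cancels in the Wronskian of the state with its [z]-derivative,
    and each step lowers that Wronskian by the form of [energy_form_gt0], so a single step already
    makes the sign strict. *)
Lemma sol_derive a z X k : exists d1 d2 : R,
  [/\ is_derive z 1 (fun z => (sol a z X k).1) d1,
      is_derive z 1 (fun z => (sol a z X k).2) d2,
      (sol a z X k).1 * d2 - (sol a z X k).2 * d1 <= 0 &
      (0 < k)%N -> X != (0, 0) ->
        (sol a z X k).1 * d2 - (sol a z X k).2 * d1 < 0].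
Proof.
elim: k => [|k [d1 [d2 [h1 h2 q_le q_lt]]]].
  by exists 0, 0; split => //=; rewrite ?mulr0 ?subrr//; exact: is_derive_cst.
set x1 := (sol a z X k).1 in q_le q_lt *.
set x2 := (sol a z X k).2 in q_le q_lt *.
set c := ccs z; set s := scs z; set d := dscs z.
set e1 := - 2^-1 * s * x1 + c * d1 + (d * x2 + s * d2).
set e2 := - (s + z * d) * x1 - z * s * d1 + (- 2^-1 * s * x2 + c * d2) + a k * e1.
have he1 : is_derive z 1 (fun z => (sol a z X k.+1).1) e1.
  by apply: is_derive_eq; rewrite /GRing.scale/= /e1 -/x1 -/x2 -/c -/s -/d; ring.
have he2 : is_derive z 1 (fun z => (sol a z X k.+1).2) e2.
  apply: is_derive_eq; rewrite /GRing.scale/= /e2 /e1 -/x1 -/x2 -/c -/s -/d; ring.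
have E : (sol a z X k.+1).1 * e2 - (sol a z X k.+1).2 * e1 =
    (x1 * d2 - x2 * d1) - (2^-1 * (1 + c * s) * x1 ^+ 2 + s ^+ 2 * x1 * x2 +
      (2^-1 * s ^+ 2 + c * d) * x2 ^+ 2).
  have dE := dscsE z; have cE := ccs2_scs2 z.
  rewrite /= -/x1 -/x2 -/c -/s /e2.
  (* The factors [c^2 + z s^2] and [2 z d - (c - s)] are displayed so that they can be replaced by 1
     and 0. *)
  transitivity ((c ^+ 2 + z * s ^+ 2) * (x1 * d2 - x2 * d1) -
     (2^-1 * ((c ^+ 2 + z * s ^+ 2) + c * (s + (2 * z * d - (c - s)))) * x1 ^+ 2
      + s ^+ 2 * x1 * x2 + (2^-1 * s ^+ 2 + c * d) * x2 ^+ 2)).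
    by rewrite /e1; field.
  by rewrite cE dE subrr addr0 mul1r.
exists e1, e2; split => //; rewrite E.
- have [x0|x0] := eqVneq (x1, x2) (0, 0).
    by case: x0 q_le => -> ->; rewrite !mul0r expr0n/= !mulr0 ?mul0r !(subr0, addr0).
  by have := energy_form_gt0 z x0; rewrite -/c -/s -/d; lra.
- move=> _ X0; have x0 : (x1, x2) != (0, 0) by rewrite -surjective_pairing sol_neq0.
  by have := energy_form_gt0 z x0; rewrite -/c -/s -/d; lra.
Qed.

(** The trace of the transfer matrix: the Hill discriminant when [k] is the period. As the
    determinant is 1, a number [sg] with [sg^2 = 1] is an eigenvalue exactly when the trace is
    [2 * sg]. *)
Definition discr a k z : R := (sol a z (1, 0) k).1 + (sol a z (0, 1) k).2.

Lemma sol_continuous a X k :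
  continuous (fun z => (sol a z X k).1) /\ continuous (fun z => (sol a z X k).2).
Proof.
by split=> z; have [d1 [d2 [h1 h2 _ _]]] := sol_derive a z X k;
  apply/differentiable_continuous/derivable1_diffP; exact: ex_derive.
Qed.

(** At a zero of the first component the Wronskian of [sol_derive] reduces to a single product, and
    its strict sign keeps the derivative from vanishing. *)
Lemma dirichlet_simple a k z : (0 < k)%N -> (sol a z (0, 1) k).1 = 0 ->
  exists2 d : R, is_derive z 1 (fun z => (sol a z (0, 1) k).1) d & d != 0.
Proof.
move=> k0 h; have [d1 [d2 [h1 h2 _]]] := sol_derive a z (0, 1) k.
move=> /(_ k0); rewrite h mul0r sub0r oppr_lt0 => q; exists d1 => //.
apply/eqP => d0; suff : 0 < (sol a z (0, 1) k).2 * d1 by rewrite d0 mulr0 ltxx.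
by apply: q; apply/eqP => -[] /eqP; rewrite oner_eq0.
Qed.

(* At the level [2 sg] the quadratic form expressing the derivative of the trace
   through the Wronskian form is a multiple of a square of a linear form. *)
Lemma discr_simple a k z (sg : R) : (0 < k)%N -> sg ^+ 2 = 1 ->
  discr a k z = 2 * sg -> ~ (sol a z (1, 0) k = (sg, 0) /\ sol a z (0, 1) k = (0, sg)) ->
  exists2 d : R, is_derive z 1 (discr a k) d & d != 0.
Proof.
move=> k0 sg2 D nI.
have [f1 [f2 [hf1 hf2 _ _]]] := sol_derive a z (1, 0) k.
have [g1 [g2 [hg1 hg2 _ _]]] := sol_derive a z (0, 1) k.
pose A y := (sol a y (1, 0) k).1; pose C y := (sol a y (1, 0) k).2.
pose B y := (sol a y (0, 1) k).1; pose E y := (sol a y (0, 1) k).2.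
have hd : is_derive z 1 (discr a k) (f1 + g2) by exact: is_deriveD.
exists (f1 + g2) => //.
have W0 : f1 * E z + A z * g2 - (f2 * B z + C z * g1) = 0.
  have hW : is_derive z 1 (fun y => A y * E y - C y * B y)
      (f1 * E z + A z * g2 - (f2 * B z + C z * g1)).
    by apply: is_derive_eq; rewrite /GRing.scale/=; ring.
  have hW' : is_derive z (1 : R) (fun y => A y * E y - C y * B y) 0.
    rewrite (_ : (fun y => _) = cst 1); first exact: is_derive_cst.
    by apply/funext => y; rewrite /A /B /C /E sol_det.
  by rewrite -(derive_val (is_derive := hW)) (derive_val (is_derive := hW')).
have qX X : X != (0, 0) ->
   (X.1 * A z + X.2 * B z) * (X.1 * f2 + X.2 * g2) -
   (X.1 * C z + X.2 * E z) * (X.1 * f1 + X.2 * g1) < 0.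
  move=> X0; have [d1 [d2 [hd1 hd2 _]]] := sol_derive a z X k.
  move=> /(_ k0 X0); have [-> ->] := sol_lin a z X k.
  have l1 : (fun y => (sol a y X k).1) = (fun y => X.1 * A y + X.2 * B y).
    by apply/funext => y; have [] := sol_lin a y X k.
  have l2 : (fun y => (sol a y X k).2) = (fun y => X.1 * C y + X.2 * E y).
    by apply/funext => y; have [] := sol_lin a y X k.
  have -> : d1 = X.1 * f1 + X.2 * g1.
    have hd1' : is_derive z 1 (fun y => (sol a y X k).1) (X.1 * f1 + X.2 * g1).
      by rewrite l1; apply: is_derive_eq; rewrite /GRing.scale/=; ring.
    by rewrite -(derive_val (is_derive := hd1)) (derive_val (is_derive := hd1')).
  have -> // : d2 = X.1 * f2 + X.2 * g2.
  have hd2' : is_derive z 1 (fun y => (sol a y X k).2) (X.1 * f2 + X.2 * g2).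
    by rewrite l2; apply: is_derive_eq; rewrite /GRing.scale/=; ring.
  by rewrite -(derive_val (is_derive := hd2)) (derive_val (is_derive := hd2')).
have det := sol_det a z k; rewrite -/(A z) -/(B z) -/(C z) -/(E z) in det.
rewrite /discr -/(A z) -/(E z) in D.
(* Vanishing discriminant of the characteristic polynomial: [sg] is a double eigenvalue. *)
have Q : (E z - A z) ^+ 2 + 4 * (B z * C z) = 0.
  transitivity ((A z + E z) ^+ 2 - 4 * (A z * E z - C z * B z)); first by ring.
  by rewrite D det exprMn sg2; ring.
have [b0|b0] := eqVneq (B z) 0.
  move: Q; rewrite b0 mul0r mulr0 addr0 => /eqP; rewrite sqrf_eq0 subr_eq0 => /eqP ea.
  have eA : A z = sg by move: D; rewrite ea; lra.
  have c0 : C z != 0.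
    apply/eqP => c0; apply: nI; split.
      by rewrite [LHS]surjective_pairing -/(A z) -/(C z) c0 eA.
    by rewrite [LHS]surjective_pairing -/(B z) -/(E z) b0 ea eA.
  (* Triangular case with [C z] nonzero. Testing with [(0, 1)] shows that [g1] is nonzero, while a
     vanishing trace derivative would force [C z * g1 = 0] through [W0]. *)
  have := qX (0, 1); rewrite /= !mul0r !mul1r !add0r b0 mul0r sub0r oppr_lt0 => q.
  have {}q : 0 < E z * g1.
    by apply: q; apply/eqP => -[] /eqP; rewrite oner_eq0.
  apply/eqP => fg0.
  have : C z * g1 = 0.
    have := W0; rewrite ea b0 mulr0 add0r mulrC -mulrDr fg0 mulr0 sub0r => /eqP.
    by rewrite oppr_eq0 => /eqP.
  move/eqP; rewrite mulf_eq0 (negbTE c0)/= => /eqP g0.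
  by move: q; rewrite g0 mulr0 ltxx.
(* This vector is an eigenvector for [sg]; along it the Wronskian form is a multiple of the trace
   derivative, which therefore cannot vanish. *)
have := qX (2 * B z, E z - A z); rewrite /= => q.
have {}q : (2 * B z * A z + (E z - A z) * B z) * (2 * B z * f2 + (E z - A z) * g2) -
    (2 * B z * C z + (E z - A z) * E z) * (2 * B z * f1 + (E z - A z) * g1) < 0.
  apply: q; apply/eqP => -[] /eqP; rewrite mulf_eq0 (negbTE b0) orbF.
  by rewrite pnatr_eq0.
apply: contraTneq q => fg0; rewrite -leNgt.
have eg : g2 = - f1 by lra.
rewrite le_eqVlt; apply/orP; left; apply/eqP/esym.
rewrite eg in W0 *.
move: (A z) (B z) (C z) (E z) Q W0 b0 => xA xB xC xE Q W0 b0.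
transitivity (- (2 * xB * (xA + xE)) * (f1 * xE + xA * - f1 - (f2 * xB + xC * g1))
  - 2^-1 * ((xE - xA) ^+ 2 + 4 * (xB * xC)) *
    (2 * xB * f1 + (xE - xA) * g1 + (xA + xE) * g1)); first by field.
by rewrite W0 Q !mulr0 mul0r subrr.
Qed.
End Transfer.

(** * High and low energy behaviour of the discriminant *)

Section Spectrum.
Variable R : realType.
Implicit Types (al x y z t : R) (a : nat -> R) (X : R * R).

(** At energy [t^2], with the derivative measured in units of [t], a free step is the rotation by
    the angle [t], and a coupling enters only with a factor [1 / t]. *)
Lemma sol_asymp a X k : exists2 C : R, 0 <= C & forall t, 1 <= t ->
  `|(sol a (t ^+ 2) (X.1, t * X.2) k).1 - (X.1 * cos (k%:R * t) + X.2 * sin (k%:R * t))|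
    <= C / t /\
  `|(sol a (t ^+ 2) (X.1, t * X.2) k).2 / t -
    (X.2 * cos (k%:R * t) - X.1 * sin (k%:R * t))| <= C / t.
Proof.
elim: k => [|k [C C0 IH]].
  exists 0 => // t t1; rewrite /= !mul0r cos0 sin0 !mulr1 !mulr0 subr0 addr0.
  have t0 : t != 0 by rewrite gt_eqF// (lt_le_trans _ t1).
  by rewrite mulrAC divff// mul1r !subrr normr0.
pose K := `|X.1| + `|X.2|.
have K0 : 0 <= K by rewrite addr_ge0.
(* A rotation at most doubles the old error; the coupling multiplies the new value, which is at most
   [K + 2 * C]. *)
exists (2 * C + `|a k| * (K + 2 * C)).
  by rewrite addr_ge0 ?mulr_ge0// addr_ge0// mulr_ge0.
move=> t t1; have t0 : 0 < t by rewrite (lt_le_trans _ t1).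
have [] := IH _ t1; rewrite /= -natr1 mulrDl mul1r cosD sinD.
have [-> sE] := cos_scs t.
set x1 := (sol _ _ _ _).1; set x2 := (sol _ _ _ _).2.
set ck := cos _; set sk := sin _; set c := cos t; set s := sin t.
set P := X.1 * ck + X.2 * sk; set Q := X.2 * ck - X.1 * sk => e1 e2.
set y1 := c * x1 + _.
have y1E : y1 = c * x1 + s * (x2 / t).
  by rewrite /y1 /s -sE; field; rewrite gt_eqF.
have h1 : `|y1 - (X.1 * (ck * c - sk * s) + X.2 * (sk * c + ck * s))| <= 2 * C / t.
  rewrite y1E (_ : _ - _ = c * (x1 - P) + s * (x2 / t - Q)); last by rewrite /P /Q; ring.
  rewrite (le_trans (ler_normD _ _))// -mulrA mulr_natl mulr2n !normrM lerD//.
    by rewrite (le_trans _ e1)// ler_piMl// cos_max.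
  by rewrite (le_trans _ e2)// ler_piMl// sin_max.
have Ct0 : 0 <= C / t by rewrite divr_ge0// ltW.
split.
  rewrite (le_trans h1)// ler_pM2r ?invr_gt0// lerDl mulr_ge0// addr_ge0// mulr_ge0//.
have y1K : `|y1| <= K + 2 * C.
  rewrite -(subrK (X.1 * (ck * c - sk * s) + X.2 * (sk * c + ck * s)) y1).
  rewrite (le_trans (ler_normD _ _))// [leRHS]addrC; apply: lerD.
    by rewrite (le_trans h1)// ler_piMr ?mulr_ge0// invf_le1.
  rewrite /ck /sk /c /s -cosD -sinD (le_trans (ler_normD _ _))// !normrM.
  by rewrite /K lerD// ler_piMr// ?cos_max ?sin_max.
rewrite (_ : _ - _ = (c * (x2 / t - Q) - s * (x1 - P)) + a k * (y1 / t)); last first.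
  rewrite -/y1 /P /Q /s -sE; field; by rewrite gt_eqF.
rewrite (le_trans (ler_normD _ _))// [leRHS]mulrDl lerD//.
  rewrite (le_trans (ler_normB _ _))// -mulrA mulr_natl mulr2n !normrM lerD//.
    by rewrite (le_trans _ e2)// ler_piMl// cos_max.
  by rewrite (le_trans _ e1)// ler_piMl// sin_max.
rewrite !normrM (gtr0_norm (_ : 0 < t^-1)) ?invr_gt0//.
by rewrite mulrA ler_pM2r ?invr_gt0// ler_wpM2l.
Qed.

Lemma discr_asymp a k : exists2 C : R, 0 <= C & forall t, 1 <= t ->
  `|t * (sol a (t ^+ 2) (0, 1) k).1 - sin (k%:R * t)| <= C / t /\
  `|discr a k (t ^+ 2) - 2 * cos (k%:R * t)| <= C / t.
Proof.
have [C C0 hC] := sol_asymp a (1, 0) k.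
have [D D0 hD] := sol_asymp a (0, 1) k.
exists (C + D) => [|t t1]; first exact: addr_ge0.
have t0 : 0 < t by rewrite (lt_le_trans _ t1).
have {hD} := hD _ t1; rewrite /= mulr1 !mul1r !mul0r add0r subr0 => -[].
have [-> ->] := sol_lin a (t ^+ 2) (0, t) k; rewrite /= !mul0r !add0r => h1 h2.
have {hC} [] := hC _ t1; rewrite /= mulr0 !mul1r !mul0r addr0 => h3 _.
have t'0 : 0 <= t^-1 by rewrite invr_ge0 ltW.
split; first by rewrite (le_trans h1)// ler_wpM2r// lerDr.
rewrite mulrAC divff ?gt_eqF// mul1r in h2.
rewrite [leRHS]mulrDl /discr (_ : _ - _ = (((sol a (t ^+ 2) (1, 0) k).1 - cos (k%:R * t)) +
  ((sol a (t ^+ 2) (0, 1) k).2 - cos (k%:R * t)))); last by ring.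
by rewrite (le_trans (ler_normD _ _))// lerD.
Qed.

Lemma discr_continuous a k : continuous (discr a k).
Proof.
move=> z; have [_ c2] := sol_continuous a (0, 1) k.
have [c1 _] := sol_continuous a (1, 0) k.
by apply: cvgD; [exact: c1|exact: c2].
Qed.

(* At a Dirichlet eigenvalue (upper right entry zero) the diagonal entries are
   mutually inverse, so that |discr| >= 2 there. *)
Lemma discr_unbounded_levels a k (b : nat) (M : R) : (0 < k)%N ->
  exists2 z, M <= z & discr a k z = 2 * (-1) ^+ b.
Proof.
move=> k0; have [C C0 hC] := discr_asymp a k.
have k0' : 0 < k%:R :> R by rewrite ltr0n.
pose n := (Num.truncn ((`|M| + C + 1) * k%:R)).+1.
(* [m] is large and has the parity of [b]. On [[t1, t2]] the phase [k t] runs over the half period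
   of the cosine centred at [pi m]. *)
pose m := (b + n.*2)%N.
have sgm : (-1) ^+ m = (-1) ^+ b :> R by rewrite exprD -muln2 exprM sqrr_sign mulr1.
pose t1 : R := (- (pi / 2) + pi *+ m) / k%:R.
pose t2 : R := (pi / 2 + pi *+ m) / k%:R.
have pi2 := pi_ge2 R.
have t1M : `|M| + C + 1 < t1.
  rewrite /t1 ltr_pdivlMr// (@lt_le_trans _ _ n%:R)//.
    by rewrite /n real_truncnS_gt ?num_real.
  rewrite -mulr_natr.
  have : n.*2%:R <= m%:R :> R by rewrite ler_nat leq_addl.
  have : 1 <= n%:R :> R by rewrite ler1n.
  rewrite -muln2 natrM; nra.
have M0 : 0 <= `|M| by [].
have t1t2 : t1 <= t2 by rewrite ler_pM2r ?invr_gt0// lerD2r; lra.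
have kt1 : k%:R * t1 = - (pi / 2) + pi *+ m by rewrite mulrC divfK// gt_eqF.
have kt2 : k%:R * t2 = pi / 2 + pi *+ m by rewrite mulrC divfK// gt_eqF.
have Ct t : t1 <= t -> C / t < 1 by move=> tt; rewrite ltr_pdivrMr; lra.
have sqr_cont (f : R -> R) (t : R) : continuous f -> {for t, continuous (fun t => f (t ^+ 2))}.
  move=> cf; apply: (@continuous_comp _ _ _ (fun t => t ^+ 2) f); last exact: cf.
  exact: exprn_continuous.
(* At the two ends [sin (k t)] equals 1 and -1 in some order and the error is below 1, so the upper
   right entry changes sign. *)
have [t0 + g0] : exists2 t0, t0 \in `[t1, t2] & t0 * (sol a (t0 ^+ 2) (0, 1) k).1 = 0.
  apply: (@IVT _ (fun t => t * (sol a (t ^+ 2) (0, 1) k).1)) => //.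
    apply: continuous_subspaceT => t; apply: cvgM; first exact: cvg_id.
    by apply: (sqr_cont (fun z => (sol a z (0, 1) k).1)); case: (sol_continuous a (0, 1) k).
  have [h1 _] := hC t1 ltac:(lra); have := Ct t1 (lexx _).
  have [h2 _] := hC t2 ltac:(lra); have := Ct t2 t1t2.
  move: h1 h2; rewrite kt1 kt2 !(alternatingn (@sinDpi R)) sinN sin_pihalf.
  move: (t1 * _) (t2 * _) (C / t1) (C / t2) => g1 g2 e1 e2.
  rewrite !ler_norml ge_min le_max mulrN !mulr1 opprK.
  rewrite -signr_odd; case: odd; rewrite ?expr0 ?expr1 => /andP[h1 h2] /andP[h3 h4] h5 h6.
    by apply/andP; split; apply/orP; [right|left]; lra.
  by apply/andP; split; apply/orP; [left|right]; lra.
rewrite in_itv/= => /andP[t10 t02].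
have t0_gt0 : 0 < t0 by lra.
have D4 : 4 <= discr a k (t0 ^+ 2) ^+ 2.
  move/eqP: g0; rewrite mulf_eq0 gt_eqF//= => /eqP g0.
  have := sol_det a (t0 ^+ 2) k; rewrite g0 mulr0 subr0 /discr.
  by move: (_.1) (_.2) => A E AE; have := sqr_ge0 (A - E); nra.
(* The trace has absolute value at least 2, and it is within 1 of [2 cos (k t0)], which has the sign
   [(-1)^m] or vanishes; this fixes its sign. *)
have D2 : 2 <= (-1) ^+ m * discr a k (t0 ^+ 2).
  have cos0 : 0 <= (-1) ^+ m * cos (k%:R * t0).
    rewrite -(subrK (pi *+ m) (k%:R * t0)) (alternatingn (@cosDpi R)) mulrA.
    rewrite -expr2 sqrr_sign mul1r cos_ge0_pihalf//.
    have : k%:R * t1 <= k%:R * t0 by rewrite ler_pM2l.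
    have : k%:R * t0 <= k%:R * t2 by rewrite ler_pM2l.
    rewrite kt1 kt2; move: (pi *+ m) (k%:R * t0) => P u h1 h2.
    by apply/andP; split; lra.
  have [_] := hC t0 ltac:(lra); have := Ct t0 t10.
  move: D4 cos0; rewrite -signr_odd.
  move: (discr _ _ _) (cos _) (C / t0) => D c e; rewrite ler_norml.
  by case: odd; rewrite ?expr0 ?expr1 => D4 cos0 e1 /andP[h1 h2]; nra.
(* At [t1] the cosine vanishes, so the signed trace is below 1 there, whereas it is at least 2 at
   [t0]. *)
have [t + Dt] : exists2 t, t \in `[t1, t0] & (-1) ^+ m * discr a k (t ^+ 2) = 2.
  apply: (@IVT _ (fun t => (-1) ^+ m * discr a k (t ^+ 2))) => //.
    apply: continuous_subspaceT => t; apply: cvgM; first exact: cvg_cst.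
    exact/sqr_cont/discr_continuous.
  rewrite ge_min le_max D2 orbT andbT; apply/orP; left.
  have [_] := hC t1 ltac:(lra); have := Ct t1 (lexx _).
  rewrite kt1 (alternatingn (@cosDpi R)) cosN cos_pihalf mulr0 mulr0 subr0.
  move: (discr _ _ _) (C / t1) => D e; rewrite ler_norml -signr_odd.
  by case: odd; rewrite ?expr0 ?expr1 => e1 /andP[h1 h2]; lra.
rewrite in_itv/= => /andP[t1t tt0]; exists (t ^+ 2).
  have := ler_norm M; nra.
by rewrite -sgm -Dt mulrAC -expr2 sqrr_sign mul1r.
Qed.

(** For very negative [z] all entries of a one-step matrix are at least 2, and this persists under
    multiplication. *)
Lemma discr_gt2 a k : (0 < k)%N -> exists M : R, forall z, z <= M -> 2 < discr a k z.
Proof.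
move=> k0; pose A : R := \sum_(i < k) `|a i|.
have A0 : 0 <= A by apply: sumr_ge0.
have aA i : (i < k)%N -> `|a i| <= A.
  by move=> ik; rewrite /A (bigD1 (Ordinal ik))//= lerDl sumr_ge0.
(* For [r = sqrt (- z) >= A + 3] one has [r s <= c <= 1 + r s], so the free entries [r^2 s] and [c]
   outweigh couplings bounded by [A]. *)
exists (- (A + 3) ^+ 2) => z zM.
pose y := - z; pose r := Num.sqrt y.
have y0 : 0 <= y by rewrite oppr_ge0 (le_trans zM)// oppr_le0 sqr_ge0.
have ry : r ^+ 2 = y by rewrite sqr_sqrtr.
have r0 : 0 <= r by exact: sqrtr_ge0.
have rA : A + 3 <= r.
  by rewrite -(@ler_pXn2r _ 2)// ?nnegrE ?addr_ge0// ry lerNr.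
have [cge sge] := ccs_scs_neg_ge y0; have cE := ccs2_scs2 z.
rewrite opprK in cge sge.
set c := ccs z in cge cE; set s := scs z in sge cE.
have y9 : 9 <= y by nra.
have s2 : 2 <= s by lra.
have c2 : 2 <= c by lra.
have cE' : c ^+ 2 = 1 + (r * s) ^+ 2 by rewrite exprMn ry -cE /y; ring.
have rs : 2 <= r * s by nra.
have c_ge : r * s <= c by rewrite -(@ler_pXn2r _ 2)// ?nnegrE; nra.
have c_le : c <= 1 + r * s by rewrite -(@ler_pXn2r _ 2)// ?nnegrE; nra.
have e1 i : (i < k)%N -> 2 <= - z * s + a i * c.
  move=> ik; have := aA _ ik; rewrite ler_norml => /andP[h1 h2].
  rewrite -/y -ry; have : - (A * (1 + r * s)) <= a i * c by nra.
  nra.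
have e2 i : (i < k)%N -> 2 <= c + a i * s.
  move=> ik; have := aA _ ik; rewrite ler_norml => /andP[h1 h2].
  have h : - (A * s) <= a i * s by nra.
  nra.
have ge2 u v u' v' : 2 <= u -> 2 <= v -> 2 <= u' -> 2 <= v' -> 2 <= u * u' + v * v' :> R.
  by move=> u2 v2 u'2 v'2; nra.
have step_ge2 i X : (i < k)%N -> 2 <= X.1 -> 2 <= X.2 ->
    2 <= (step (a i) z X).1 /\ 2 <= (step (a i) z X).2.
  move=> ik X1 X2; split; first exact: ge2.
  rewrite (_ : _.2 = (- z * s + a i * c) * X.1 + (c + a i * s) * X.2).
    by apply: ge2 => //; [exact: e1|exact: e2].
  by rewrite /step/= -/c -/s; ring.
have sol_ge2 i : (i < k)%N ->
   [/\ 2 <= (sol a z (1, 0) i.+1).1, 2 <= (sol a z (1, 0) i.+1).2,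
       2 <= (sol a z (0, 1) i.+1).1 & 2 <= (sol a z (0, 1) i.+1).2].
  elim: i => [|i IH] ik.
    rewrite /= -/c -/s !mulr1 !mulr0 !addr0 !add0r; split => //; [exact: e1|exact: e2].
  have [h1 h2 h3 h4] := IH (ltnW ik).
  by have [? ?] := step_ge2 _ _ ik h1 h2; have [? ?] := step_ge2 _ _ ik h3 h4.
by have := sol_ge2 k.-1; rewrite prednK// => /(_ (leqnn _)) [h1 h2 h3 h4]; rewrite /discr; lra.
Qed.
End Spectrum.

(** * Level sets and enumerations *)

Section DiscreteSets.
Variable R : realType.
Implicit Types (f : R -> R) (v z x y lo hi : R) (Z : set R).

Lemma level_isolated f v z : continuous f ->
  (f z = v -> exists2 d : R, is_derive z 1 f d & d != 0) ->
  exists2 e : R, 0 < e & forall y, `|z - y| < e -> f y = v -> y = z.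
Proof.
move=> cf; have [fz /(_ fz) [d fd d0]|fz _] := eqVneq (f z) v; last first.
  have : \forall y \near z, f y - v != 0.
    have fzv : f y - v @[y --> z] --> f z - v by apply: cvgB; [exact: cf|exact: cvg_cst].
    by apply: (cvgr_neq0 _ fzv); rewrite subr_eq0.
  move=> /nbhs_ballP[e /= e0 h]; exists e => // y ye fy.
  by have := h y ye; rewrite fy subrr eqxx.
have : \forall h \near 0^', h^-1 *: ((f \o shift z) (h *: (1 : R)) - f z) != 0.
  apply: (@cvgr_neq0 _ _ _ _ _ _ d) => //.
  by rewrite -(derive_val (is_derive := fd)); exact: (ex_derive (is_derive := fd)).
move=> /nbhs_ballP[e /= e0 he]; exists e => // y ye fy; apply/eqP/negP => yz.
have := he (y - z); rewrite /ball/= sub0r opprB => /(_ ye).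
rewrite subr_eq0 => /(_ (introN idP yz)).
by rewrite /GRing.scale /= mulr1 subrK fy fz subrr mulr0 eqxx.
Qed.

(** Finitely many isolating balls cover the interval, and each can meet the level only at its
    centre. *)
Lemma finite_level f v lo hi : continuous f ->
  (forall z, f z = v -> exists2 d : R, is_derive z 1 f d & d != 0) ->
  finite_set ([set z | f z = v] `&` `[lo, hi]).
Proof.
move=> cf fd.
have /choice[e he] : forall z, exists e : R, 0 < e /\
    forall y, `|z - y| < e -> f y = v -> y = z.
  by move=> z; have [e e0 h] := level_isolated cf (fd z); exists e.
have cI := @segment_compact R lo hi; rewrite compact_cover in cI.
have [z _|z zI|D _ cov] := cI R [set` `[lo, hi]] (fun z => ball z (e z)).
- exact: ball_open.
- by exists z => //; apply: ballxx; have [] := he z.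
apply: sub_finite_set (finite_fset D) => y [fy /cov [z zD yz]] /=; have [_ /(_ y yz fy) ->] := he z.
exact: zD.
Qed.

Lemma countable_level f v : continuous f ->
  (forall z, f z = v -> exists2 d : R, is_derive z 1 f d & d != 0) ->
  countable [set z | f z = v].
Proof.
move=> cf fd.
have -> : [set z | f z = v] =
    \bigcup_(n in [set: nat]) ([set z | f z = v] `&` `[- n%:R, n%:R]).
  apply/seteqP; split => [z fz|z [n _ []]//].
  exists (Num.truncn `|z|).+1 => //; split => //.
  by rewrite /= in_itv/= -ler_norml ltW// real_truncnS_gt ?num_real.
apply: bigcup_countable => // n _.
exact/finite_set_countable/finite_level.
Qed.

Lemma finite_set_min Z : finite_set Z -> Z !=set0 ->
  exists2 m, Z m & forall z, Z z -> m <= z.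
Proof.
move=> /finite_seqP[s ->]; elim: s => [[]//|x s IH _].
case: s IH => [_|y s /(_ (ex_intro _ y (mem_head _ _))) [m ms hm]].
  by exists x; rewrite /= ?inE// => z; rewrite /= inE => /eqP ->.
have [xm|mx] := leP x m.
  exists x; first exact: mem_head.
  move=> z /=; rewrite in_cons => /orP[/eqP -> //|/hm]; exact: le_trans.
exists m; first by rewrite /= in_cons; apply/orP; right.
by move=> z /=; rewrite in_cons => /orP[/eqP -> //|/hm//]; exact: ltW.
Qed.

(** Iterate the map to the next element of [Z], starting from the lower bound. A missed [z] would
    stay above the whole sequence and leave infinitely many elements in [[M, z]]. *)
Lemma increasing_enum Z :
  (exists M, forall z, Z z -> M < z) ->
  (forall lo hi, finite_set (Z `&` `[lo, hi])) ->
  (forall M, exists2 z, M <= z & Z z) ->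
  exists2 l : nat -> R, {homo l : i j / (i < j)%N >-> i < j} & range l = Z.
Proof.
move=> [M ZM] Zfin Zinf.
have next x : exists m, [/\ Z m, x < m & forall z, Z z -> x < z -> m <= z].
  have [b xb Zb] := Zinf (x + 1).
  have xb' : x < b by lra.
  have [||m [] Zm] := @finite_set_min ([set z | Z z /\ x < z] `&` `[x, b]).
  - by apply: sub_finite_set (Zfin x b) => z [[? ?] ?].
  - by exists b; split=> //=; rewrite in_itv/= lexx ltW.
  move=> mxb h; exists m; split=> //; first exact: Zm.1; first exact: Zm.2.
  move=> z Zz xz; have [zb|bz] := leP z b.
    by apply: h; split=> //=; rewrite in_itv/= zb ltW.
  by move: mxb; rewrite /= in_itv/= => /andP[_ mb]; rewrite (le_trans mb)// ltW.
have {next}[nx nxP] := choice next.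
pose l n := iter n nx (nx M).
have lZ n : Z (l n) by case: n => [|n]; [have [] := nxP M|have [] := nxP (l n)].
have lS n : l n < l n.+1 by have [] := nxP (l n).
have lincr : {homo l : i j / (i < j)%N >-> i < j} by apply: homo_ltn => // ? ? ?; exact: lt_trans.
exists l => //; apply/seteqP; split=> [_ [n _ <-]//|z Zz].
apply: contrapT => nz.
have lz n : l n < z.
  elim: n => [|n IH]; rewrite lt_neqAle; apply/andP; split.
  - by apply/eqP => h; apply: nz; exists 0%N.
  - by have [_ _] := nxP M; apply => //; exact: ZM.
  - by apply/eqP => h; apply: nz; exists n.+1.
  - by have [_ _] := nxP (l n); apply.
apply: infinite_nat.
have : finite_set (range l).
  apply: sub_finite_set (Zfin M z) => _ [n _ <-]; split => //=.
  by rewrite in_itv/= !ltW// ZM.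
rewrite (eq_finite_set (inj_card_eq _))// => i j _ _ lij.
by apply/eqP; case: ltngtP => // /lincr; rewrite lij ltxx.
Qed.
End DiscreteSets.

(** * Free propagation and the integral equation *)

Section IntegralEquation.
Variable R : realType.
Local Notation mu := (@lebesgue_measure R).
Implicit Types (a b x y z : R) (f g w : R -> R).

(** [cos (sqrt z x)] and [sin (sqrt z x) / sqrt z], for real [z] of any sign: the solutions of
    [-u'' = z u] with data [(1, 0)] and [(0, 1)] at 0. *)
Definition cprop z x : R := ccs (z * x ^+ 2).
Definition sprop z x : R := x * scs (z * x ^+ 2).

Lemma is_derive_cprop z x : is_derive x 1 (cprop z) (- z * sprop z x).
Proof.
have e1 : is_derive x (1 : R) (fun t : R => z * t ^+ 2) (z * (2 * x)).
  by apply: is_derive_eq; rewrite /GRing.scale/=; ring.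
rewrite (_ : - z * _ = (- 2^-1 * scs (z * x ^+ 2)) * (z * (2 * x))).
  exact: (@is_derive1_comp _ (@ccs R) (fun t => z * t ^+ 2) _ _ _ (is_derive_ccs _)).
by rewrite /sprop; field.
Qed.

Lemma is_derive_sprop z x : is_derive x 1 (sprop z) (cprop z x).
Proof.
have e1 : is_derive x (1 : R) (fun t : R => z * t ^+ 2) (z * (2 * x)).
  by apply: is_derive_eq; rewrite /GRing.scale/=; ring.
have e2 : is_derive x (1 : R) (fun t : R => scs (z * t ^+ 2))
    (dscs (z * x ^+ 2) * (z * (2 * x))).
  exact: (@is_derive1_comp _ (@scs R) (fun t => z * t ^+ 2) _ _ _ (is_derive_scs _)).
apply: is_derive_eq; rewrite /GRing.scale/=.
have := dscsE (z * x ^+ 2) => h; rewrite /cprop.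
transitivity (2 * (z * x ^+ 2) * dscs (z * x ^+ 2) + scs (z * x ^+ 2)); first by ring.
by rewrite h subrK.
Qed.

Lemma cprop0 z : cprop z 0 = 1.
Proof. by rewrite /cprop expr0n mulr0 ccs0. Qed.

Lemma sprop0 z : sprop z 0 = 0.
Proof. by rewrite /sprop mul0r. Qed.

Lemma cprop1 z : cprop z 1 = ccs z.
Proof. by rewrite /cprop expr1n mulr1. Qed.

Lemma sprop1 z : sprop z 1 = scs z.
Proof. by rewrite /sprop expr1n mulr1 mul1r. Qed.

Lemma cprop2_sprop2 z x : cprop z x ^+ 2 + z * sprop z x ^+ 2 = 1.
Proof. by rewrite -[RHS](ccs2_scs2 (z * x ^+ 2)) /cprop /sprop; ring. Qed.

Definition free (z a : R) (X : R * R) x : R :=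
  X.1 * cprop z (x - a) + X.2 * sprop z (x - a).
Definition dfree (z a : R) (X : R * R) x : R :=
  - z * X.1 * sprop z (x - a) + X.2 * cprop z (x - a).

Lemma is_derive_cprop_shift z a x :
  is_derive x 1 (fun x => cprop z (x - a)) (- z * sprop z (x - a)).
Proof.
have e1 : is_derive x (1 : R) (fun t : R => t - a) 1.
  by apply: is_derive_eq; rewrite subr0.
rewrite -[- z * _]mulr1.
exact: (@is_derive1_comp _ (cprop z) (fun t => t - a) _ _ _ (is_derive_cprop _ _)).
Qed.

Lemma is_derive_sprop_shift z a x :
  is_derive x 1 (fun x => sprop z (x - a)) (cprop z (x - a)).
Proof.
have e1 : is_derive x (1 : R) (fun t : R => t - a) 1.
  by apply: is_derive_eq; rewrite subr0.
rewrite -[cprop _ _]mulr1.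
exact: (@is_derive1_comp _ (sprop z) (fun t => t - a) _ _ _ (is_derive_sprop _ _)).
Qed.

#[local] Existing Instance is_derive_cprop_shift.
#[local] Existing Instance is_derive_sprop_shift.

Lemma is_derive_free z a X x : is_derive x 1 (free z a X) (dfree z a X x).
Proof. by apply: is_derive_eq; rewrite /GRing.scale/= /dfree; ring. Qed.

Lemma is_derive_dfree z a X x : is_derive x 1 (dfree z a X) (- z * free z a X x).
Proof. by apply: is_derive_eq; rewrite /GRing.scale/= /free; ring. Qed.

Lemma is_derive_continuous f x d : is_derive x 1 f d -> {for x, continuous f}.
Proof.
by move=> h; apply/differentiable_continuous/derivable1_diffP; exact: ex_derive.
Qed.

Lemma free_continuous z a X : continuous (free z a X).
Proof. by move=> x; exact: is_derive_continuous (is_derive_free z a X x). Qed.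

Lemma dfree_continuous z a X : continuous (dfree z a X).
Proof. by move=> x; exact: is_derive_continuous (is_derive_dfree z a X x). Qed.

Lemma near_itvoo a b x (P : R -> Prop) : a < x -> x < b ->
  (forall y, a < y -> y < b -> P y) -> \forall y \near x, P y.
Proof.
move=> ax xb h; have xI : x \in `]a, b[ by rewrite in_itv/= ax xb.
by apply: filterS (near_in_itvoo xI) => y; rewrite in_itv/= => /andP[]; exact: h.
Qed.

(** * Regularity of integral functions *)

Section Primitive.
Variables (a b : R) (f g : R -> R).
Hypothesis gi : forall x y, a < x -> x <= y -> y < b ->
  mu.-integrable `[x, y] (EFin \o g).
Hypothesis fg : forall x y, a < x -> x <= y -> y < b ->
  f y - f x = \int[mu]_(t in `[x, y]) g t.

Lemma primitive_continuous x : a < x -> x < b -> {for x, continuous f}.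
Proof.
move=> ax xb; pose l := (a + x) / 2; pose r := (x + b) / 2.
have al : a < l by rewrite /l; lra.
have lx : l < x by rewrite /l; lra.
have xr : x < r by rewrite /r; lra.
have rb : r < b by rewrite /r; lra.
have lr : l < r by lra.
have := parameterized_integral_continuous (ltW lr) (gi al (ltW lr) rb).
move=> /(continuous_within_itvP _ lr)[+ _ _] => /(_ x).
rewrite in_itv/= lx xr => /(_ isT) c.
pose F y := f l + parameterized_integral mu l y g.
have FE y : l < y -> y < r -> F y = f y.
  move=> ly yr; rewrite /F /parameterized_integral -fg ?ltW//; last exact: lt_trans yr rb.
  by rewrite addrC subrK.
have Fc : F y @[y --> x] --> f x by rewrite -FE//; apply: cvgD; [exact: cvg_cst|exact: c].
rewrite /continuous_at; apply: cvg_trans Fc; apply: near_eq_cvg.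
exact: near_itvoo lx xr FE.
Qed.

Lemma primitive_derive x : a < x -> x < b ->
  (forall x, a < x -> x < b -> {for x, continuous g}) -> is_derive x 1 f (g x).
Proof.
move=> ax xb gc; pose l := (a + x) / 2; pose r := (x + b) / 2.
have al : a < l by rewrite /l; lra.
have lx : l < x by rewrite /l; lra.
have xr : x < r by rewrite /r; lra.
have rb : r < b by rewrite /r; lra.
have lr : l < r by lra.
have [d1 d2] := continuous_FTC1_closed xr (gi al (ltW lr) rb) lx (gc x ax xb).
pose F y := f l + (\int[mu]_(t in `[l, y]) g t).
have dG : is_derive x 1 (fun y => \int[mu]_(t in `[l, y]) g t) (g x).
  by apply: DeriveDef; [exact: d1|rewrite -derive1E; exact: d2].
have dF : is_derive x 1 F (g x).
  by have := is_deriveD (is_derive_cst (f l) x 1) dG; rewrite add0r.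
apply: near_eq_is_derive dF; apply: near_itvoo lx xr _ => y ly yr.
by rewrite /F -fg// ?ltW// 1?addrC ?subrK// (lt_trans yr).
Qed.
End Primitive.

Lemma derive0_itv_const (f : R -> R) a b : (forall x, a < x -> x < b -> is_derive x 1 f 0) ->
  forall x y, a < x -> x < b -> a < y -> y < b -> f x = f y.
Proof.
move=> h x y; wlog xy : x y / x <= y.
  move=> H; have [xy|yx] := leP x y; first exact: H.
  by move=> *; apply/esym/H => //; exact: ltW.
move=> ax xb ay yb.
have [|| c _] := @MVT_segment _ f (fun=> 0) x y xy.
- by move=> t /[!in_itv]/= /andP[xt ty]; apply: h; lra.
- apply: derivable_within_continuous => t /[!in_itv]/= /andP[xt ty].
  by apply: (ex_derive (is_derive := h t _ _)); lra.
by rewrite mul0r => /eqP; rewrite subr_eq0 => /eqP ->.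
Qed.

(** Bootstrap: [f] is continuous, so [w] may be replaced under the integral by the continuous
    [- z f], which makes [f] and [g] differentiable. The anchor [e] may lie outside the interval, as
    happens for the first half-piece of the cell. *)
Lemma integral_ode a b z f g w : a < b ->
  (forall x y, a < x -> x <= y -> y < b -> mu.-integrable `[x, y] (EFin \o g)) ->
  (forall x y, a < x -> x <= y -> y < b -> mu.-integrable `[x, y] (EFin \o w)) ->
  (forall x y, a < x -> x <= y -> y < b ->
    f y - f x = \int[mu]_(t in `[x, y]) g t) ->
  (forall x y, a < x -> x <= y -> y < b ->
    g y - g x = \int[mu]_(t in `[x, y]) w t) ->
  {ae mu, forall x, a < x -> x < b -> w x = - z * f x} ->
  forall e, exists X, forall x, a < x -> x < b -> f x = free z e X x /\ g x = dfree z e X x.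
Proof.
move=> ab gi wi fg gw wE e.
have cf := primitive_continuous gi fg.
have czf x : a < x -> x < b -> {for x, continuous (fun x => - z * f x)}.
  by move=> ax xb; apply: cvgM; [exact: cvg_cst|exact: cf].
have zfi x y : a < x -> x <= y -> y < b ->
    mu.-integrable `[x, y] (EFin \o (fun x => - z * f x)).
  move=> ax xy yb; apply: continuous_compact_integrable; first exact: segment_compact.
  apply: continuous_in_subspaceT => t; rewrite inE/= in_itv/= => /andP[xt ty].
  by apply: czf; lra.
have gzf x y : a < x -> x <= y -> y < b ->
    g y - g x = \int[mu]_(t in `[x, y]) (- z * f t).
  move=> ax xy yb; rewrite gw// /Rintegral; congr fine.
  apply: ae_eq_integral => //.
  - by case/integrableP: (wi _ _ ax xy yb).
  - by case/integrableP: (zfi _ _ ax xy yb).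
  - apply: (filterS (F := almost_everywhere mu)) wE => t h /=; rewrite in_itv/= => /andP[xt ty].
    by rewrite h//; lra.
have cg := primitive_continuous zfi gzf.
have df x : a < x -> x < b -> is_derive x 1 f (g x).
  by move=> ax xb; apply: (primitive_derive gi fg).
have dg x : a < x -> x < b -> is_derive x 1 g (- z * f x).
  by move=> ax xb; apply: (primitive_derive zfi gzf).
(* [P] and [Q] carry the state at [x] back to [e] by the inverse propagator; they are constant and
   provide the data [X]. *)
pose P x := cprop z (x - e) * f x - sprop z (x - e) * g x.
pose Q x := z * sprop z (x - e) * f x + cprop z (x - e) * g x.
have dP x : a < x -> x < b -> is_derive x 1 P 0.
  move=> ax xb; have h1 := df x ax xb; have h2 := dg x ax xb.
  by apply: is_derive_eq; rewrite /GRing.scale/=; ring.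
have dQ x : a < x -> x < b -> is_derive x 1 Q 0.
  move=> ax xb; have h1 := df x ax xb; have h2 := dg x ax xb.
  by apply: is_derive_eq; rewrite /GRing.scale/=; ring.
pose m := (a + b) / 2.
have am : a < m by rewrite /m; lra.
have mb : m < b by rewrite /m; lra.
exists (P m, Q m) => x ax xb.
have <- := derive0_itv_const dP ax xb am mb; have <- := derive0_itv_const dQ ax xb am mb.
have E := cprop2_sprop2 z (x - e); rewrite /free /dfree /P /Q /=.
move: (cprop _ _) (sprop _ _) (f x) (g x) E => c s u v E.
split.
- by transitivity ((c ^+ 2 + z * s ^+ 2) * u); [rewrite E mul1r|ring].
- by transitivity ((c ^+ 2 + z * s ^+ 2) * v); [rewrite E mul1r|ring].
Qed.
End IntegralEquation.

(** * Components of the cell and one-sided limits *)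

Section ComplexLimits.
Variable R : realType.

Lemma cvg_Complex (T : Type) (F : set_system T) (FF : Filter F) (f g : T -> R) (a b : R) :
  f @ F --> a -> g @ F --> b ->
  (fun t => Complex (f t) (g t)) @ F --> (Complex a b : R[i]).
Proof.
move=> fa gb; apply/cvgrPdist_lt => -[e e']; rewrite ltcE/= => /andP[/eqP -> e0].
have e20 : 0 < e / 2 by rewrite divr_gt0.
have /cvgrPdist_lt /(_ _ e20) := gb; have /cvgrPdist_lt /(_ _ e20) := fa.
apply: filterS2 => t h1 h2; rewrite normc_def/= ltcR.
apply: (@le_lt_trans _ _ (`|a - f t| + `|b - g t|)); last by lra.
rewrite -[leRHS]ger0_norm ?addr_ge0// -sqrtr_sqr ler_wsqrtr//.
rewrite [leRHS]sqrrD !real_normK ?num_real// lerD2r lerDl.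
by rewrite mulrn_wge0 ?mulr_ge0.
Qed.

Lemma lim_Complex (T : Type) (F : set_system T) (FF : ProperFilter F)
    (u : T -> R[i]) (f g : T -> R) (a b : R) :
  (\forall t \near F, u t = Complex (f t) (g t)) ->
  f @ F --> a -> g @ F --> b -> lim (u @ F) = Complex a b.
Proof.
move=> ufg fa gb; apply: cvg_lim; first exact: norm_hausdorff.
have h := cvg_Complex FF fa gb; apply: (cvg_trans _ h); apply: near_eq_cvg.
by apply: filterS ufg => t ->.
Qed.

Lemma expi0 : expi (0 : R) = 1.
Proof. by rewrite /expi cos0 sin0. Qed.

Lemma expi_pi : expi (pi : R) = -1.
Proof. by rewrite /expi cospi sinpi; apply/eqP; rewrite eq_complex/= oppr0 !eqxx. Qed.
End ComplexLimits.

Section Pieces.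
Variable R : realType.
Local Notation mu := (@lebesgue_measure R).
Implicit Types (x y z : R) (k p : nat).

(* For [0 <= k <= p] these are the components of the cell minus the integers;
   the extreme ones have length 1/2. *)
Definition piece p k : set R :=
  [set x | [/\ - 2^-1 < x, x < p%:R - 2^-1, k%:R - 1 < x & x < k%:R]].

Lemma int_between (j : int) k x : k%:R - 1 < x -> x < k%:R -> x != j%:~R :> R.
Proof.
move=> kx xk; apply/eqP => xj; rewrite {x}xj in kx xk.
have : (k%:Z - 1)%:~R < j%:~R :> R by rewrite intrB.
have : j%:~R < k%:Z%:~R :> R by [].
by rewrite !ltr_int ltrBlDr ltzD1 => jk kj; move: (lt_le_trans jk kj); rewrite ltxx.
Qed.

Lemma piece_sub p k : piece p k `<=` @cell R p `\` @Zset R.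
Proof.
move=> x [x1 x2 x3 x4]; split; first by rewrite /cell/= in_itv/= x1 x2.
by move=> [j _ jx]; have := int_between j x3 x4; rewrite jx eqxx.
Qed.

(** Adding 1 makes the argument positive on the cell, so that [truncn] is a floor; off the integers
    it returns the [k] with [k - 1 < x < k]. *)
Lemma cellZ_piece p x : (@cell R p `\` @Zset R) x ->
  piece p (Num.truncn (x + 1)) x /\ (Num.truncn (x + 1) <= p)%N.
Proof.
rewrite /cell /= in_itv/= => -[/andP[x1 x2] xZ].
have x0 : 0 <= x + 1 by lra.
have /andP[h1 h2] := truncn_itv x0; set k := Num.truncn _ in h1 h2 *.
have kx : x != k%:R - 1.
  apply/eqP => xk; apply: xZ; exists (k%:Z - 1) => //.
  by rewrite intrB xk.
split.
  split => //; last by move: h2; rewrite -natr1; lra.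
  by rewrite lt_neqAle eq_sym kx/=; lra.
by rewrite -ltnS -(ltr_nat R) -natr1; lra.
Qed.

Lemma truncn_piece p k x : piece p k x -> Num.truncn (x + 1) = k.
Proof.
move=> [x1 x2 x3 x4]; apply: truncn_def; rewrite -natr1; apply/andP; split; lra.
Qed.

Lemma piece_itv p k x y : piece p k x -> piece p k y -> `[x, y] `<=` piece p k.
Proof.
move=> [x1 x2 x3 x4] [y1 y2 y3 y4] t; rewrite /= in_itv/= => /andP[xt ty].
by split; lra.
Qed.

Lemma itv_piece p x y : x <= y -> `[x, y] `<=` @cell R p `\` @Zset R ->
  exists2 k, (k <= p)%N & piece p k x /\ piece p k y.
Proof.
move=> xy sub; have Ux := sub x; have Uy := sub y.
have /cellZ_piece[px kp] : (@cell R p `\` @Zset R) x.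
  by apply: Ux; rewrite /= in_itv/= lexx.
have /cellZ_piece[py _] : (@cell R p `\` @Zset R) y.
  by apply: Uy; rewrite /= in_itv/= lexx andbT.
exists (Num.truncn (x + 1)) => //; split => //.
move: py px; set k := Num.truncn (x + 1); set j := Num.truncn (y + 1).
move=> [y1 y2 y3 y4] [x1 x2 x3 x4]; split => //; first by lra.
rewrite ltNge; apply/negP => ky.
have [_] : (@cell R p `\` @Zset R) k%:R.
  by apply: sub; rewrite /= in_itv/= ky ltW.
by apply; exists k%:Z.
Qed.

Lemma near_right_piece p k : (k < p)%N -> \forall x \near k%:R^'+, piece p k.+1 x.
Proof.
move=> kp; have kp' : k.+1%:R <= p%:R :> R by rewrite ler_nat.
have k0 : 0 <= k%:R :> R by rewrite ler0n.
rewrite -natr1 in kp'.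
near=> x; have kx : k%:R < x by near: x; exact: nbhs_right_gt.
have xk : x < k%:R + 2^-1 by near: x; apply: nbhs_right_lt; lra.
have E : k.+1%:R = k%:R + 1 :> R by rewrite natr1.
by split; rewrite ?E; lra.
Unshelve. all: by end_near. Qed.

Lemma near_left_piece p k : (k < p)%N -> \forall x \near k%:R^'-, piece p k x.
Proof.
move=> kp; have kp' : k.+1%:R <= p%:R :> R by rewrite ler_nat.
have k0 : 0 <= k%:R :> R by rewrite ler0n.
rewrite -natr1 in kp'.
near=> x; have kx : x < k%:R by near: x; exact: nbhs_left_lt.
have xk : k%:R - 2^-1 < x by near: x; apply: nbhs_left_gt; lra.
by split; lra.
Unshelve. all: by end_near. Qed.

Lemma near_right_cell p : (0 < p)%N -> \forall x \near (- 2^-1 : R)^'+, piece p 0 x.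
Proof.
move=> p0; have p1 : 1 <= p%:R :> R by rewrite ler1n.
near=> x; have kx : - 2^-1 < x by near: x; exact: nbhs_right_gt.
have xk : x < 0 by near: x; apply: nbhs_right_lt; lra.
by split; lra.
Unshelve. all: by end_near. Qed.

Lemma near_left_cell p : (0 < p)%N -> \forall x \near (p%:R - 2^-1 : R)^'-, piece p p x.
Proof.
move=> p0; have p1 : 1 <= p%:R :> R by rewrite ler1n.
near=> x; have kx : x < p%:R - 2^-1 by near: x; exact: nbhs_left_lt.
have xk : p%:R - 1 < x by near: x; apply: nbhs_left_gt; lra.
by split; lra.
Unshelve. all: by end_near. Qed.

Lemma countable_Zset : countable (@Zset R).
Proof. exact: card_le_trans (card_image_le _ _) (countableP _). Qed.

Lemma open_cellZ p : open (@cell R p `\` @Zset R).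
Proof.
rewrite openE => x /cellZ_piece[px _].
have [x1 x2 x3 x4] := px.
rewrite /interior.
near=> y; apply: (@piece_sub _ (Num.truncn (x + 1))).
split; near: y; [exact: lt_nbhsr|exact: lt_nbhsl|exact: lt_nbhsr|exact: lt_nbhsl].
Unshelve. all: by end_near. Qed.

Lemma measurable_cellZ p : measurable (@cell R p `\` @Zset R).
Proof. exact: (open_measurable (@open_cellZ p)). Qed.
End Pieces.

(** * From eigenfunctions to states *)

Section EigenfunctionStates.
Variable R : realType.
Local Notation mu := (@lebesgue_measure R).
Implicit Types (x y z : R) (k p : nat) (f g w : R -> R) (X : R * R).

(** On a bounded interval [|f| <= 1 + f^2 + g^2] reduces integrability to the square-integrability
    of the complex function with parts [f] and [g]. *)
Lemma L2_integrable (U : set R) f g x y : measurable U ->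
  measurable_fun U f -> measurable_fun U g ->
  (\int[mu]_(x in U) (f x ^+ 2 + g x ^+ 2)%:E < +oo)%E ->
  `[x, y] `<=` U -> mu.-integrable `[x, y] (EFin \o f).
Proof.
move=> mU' mf' mg' fin sub.
have mU : @measurable _ (measurableTypeR R) U by exact: mU'.
have mf : @measurable_fun _ _ (measurableTypeR R) R U f by exact: mf'.
have mg : @measurable_fun _ _ (measurableTypeR R) R U g by exact: mg'.
have mI : @measurable _ (measurableTypeR R) `[x, y] by exact: measurable_itv.
have mfg : @measurable_fun _ _ (measurableTypeR R) R U (fun x => f x ^+ 2 + g x ^+ 2).
  by apply: measurable_funD; apply: measurable_funX.
have intU : mu.-integrable U (EFin \o (fun x => f x ^+ 2 + g x ^+ 2)).
  apply/integrableP; split; first exact/measurable_EFinP.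
  by under eq_integral => t _ do rewrite /= ger0_norm ?addr_ge0 ?sqr_ge0//.
have intI := integrableS mU mI sub intU.
have int1 : mu.-integrable `[x, y] (EFin \o cst 1).
  apply: continuous_compact_integrable; first exact: segment_compact.
  by apply: continuous_subspaceT => t; exact: cvg_cst.
apply: le_integrable (integrableD mI int1 intI) => //.
  by apply/measurable_EFinP; exact: measurable_funS mf.
move=> t _ /=; rewrite lee_fin [leRHS]ger0_norm ?addr_ge0 ?sqr_ge0//.
have := sqr_ge0 (`|f t| - 1); have := sqr_ge0 (g t).
rewrite -[f t ^+ 2]real_normK ?num_real//; nra.
Qed.

Lemma real_states p z f g w : (0 < p)%N ->
  let U := @cell R p `\` @Zset R in
  (forall x y, `[x, y] `<=` U -> mu.-integrable `[x, y] (EFin \o g)) ->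
  (forall x y, `[x, y] `<=` U -> mu.-integrable `[x, y] (EFin \o w)) ->
  (forall x y, x <= y -> `[x, y] `<=` U -> f y - f x = \int[mu]_(t in `[x, y]) g t) ->
  (forall x y, x <= y -> `[x, y] `<=` U -> g y - g x = \int[mu]_(t in `[x, y]) w t) ->
  {ae mu, forall x, cell p x -> w x = - z * f x} ->
  exists X : nat -> R * R, forall k x, (k <= p)%N -> piece p k x ->
    f x = free z (k%:R - 1) (X k) x /\ g x = dfree z (k%:R - 1) (X k) x.
Proof.
move=> p0 U gi wi fg gw wE.
suff /choice[X XP] : forall k, exists X : R * R, forall x, (k <= p)%N -> piece p k x ->
    f x = free z (k%:R - 1) X x /\ g x = dfree z (k%:R - 1) X x.
  by exists X => k x; exact: XP.
move=> k; have [kp|pk] := leqP k p; last by exists (0, 0).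
have kp' : k%:R <= p%:R :> R by rewrite ler_nat.
have p0' : 0 < p%:R :> R by rewrite ltr0n.
have k0 : 0 <= k%:R :> R by [].
(* The piece as a single open interval; the maximum and minimum matter only for the two half-pieces
   [k = 0] and [k = p]. *)
pose a := Num.max (- 2^-1) (k%:R - 1) : R; pose b := Num.min (p%:R - 2^-1) k%:R : R.
have ab : a < b.
  by rewrite /a /b gt_max !lt_min; apply/andP; split; apply/andP; split; lra.
have abP x : a < x -> x < b -> piece p k x.
  by rewrite /a /b gt_max lt_min => /andP[? ?] /andP[? ?].
have sub x y : a < x -> x <= y -> y < b -> `[x, y] `<=` U.
  move=> ax xy yb; apply: subset_trans (@piece_sub _ _ k).
  by apply: piece_itv; apply: abP => //; [exact: le_lt_trans yb|exact: lt_le_trans xy].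
have [||||| X XP] := @integral_ode R a b z f g w ab _ _ _ _ _ (k%:R - 1).
- by move=> x y ax xy yb; apply: gi; exact: sub.
- by move=> x y ax xy yb; apply: wi; exact: sub.
- by move=> x y ax xy yb; apply: fg => //; exact: sub.
- by move=> x y ax xy yb; apply: gw => //; exact: sub.
- apply: (filterS (F := almost_everywhere mu)) wE => t h at_ tb; apply: h.
  by have [+ _] := piece_sub (abP _ at_ tb).
exists X => x _ [x1 x2 x3 x4]; apply: XP; first by rewrite gt_max x1.
by rewrite lt_min x2.
Qed.

Lemma free_at z (e : R) X x : x = e -> free z e X x = X.1 /\ dfree z e X x = X.2.
Proof. by move=> ->; rewrite /free /dfree subrr cprop0 sprop0 !mulr0 !mulr1 addr0 add0r. Qed.

Lemma free_step z k X : let K := k%:R in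
  free z (K - 1) X K = ccs z * X.1 + scs z * X.2 /\
  dfree z (K - 1) X K = - z * scs z * X.1 + ccs z * X.2.
Proof.
move=> K; rewrite /free /dfree (_ : K - (K - 1) = 1); last by ring.
by rewrite cprop1 sprop1; split; ring.
Qed.

(** The energy is real, so a complex solution is kept as two real states, [X] for the real part and
    [Y] for the imaginary part. *)
Definition cfree z e (X Y : R * R) x : R[i] := Complex (free z e X x) (free z e Y x).
Definition dcfree z e (X Y : R * R) x : R[i] := Complex (dfree z e X x) (dfree z e Y x).

(* Used both for a given eigenfunction and for one built from its states. *)
Section Limits.
Variables (p : nat) (z : R) (u v : R -> R[i]) (X Y : nat -> R * R).
Hypothesis p0 : (0 < p)%N.
Hypothesis uv : forall k x, (k <= p)%N -> piece p k x ->
  u x = cfree z (k%:R - 1) (X k) (Y k) x /\ v x = dcfree z (k%:R - 1) (X k) (Y k) x.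

Lemma lim_right k : (k < p)%N ->
  lim (u x @[x --> k%:R^'+]) = Complex (X k.+1).1 (Y k.+1).1 /\
  lim (v x @[x --> k%:R^'+]) = Complex (X k.+1).2 (Y k.+1).2.
Proof.
move=> kp; have E : k%:R = k.+1%:R - 1 :> R by rewrite -natr1 addrK.
have [X1 X2] := free_at z (X k.+1) E; have [Y1 Y2] := free_at z (Y k.+1) E.
rewrite -X1 -X2 -Y1 -Y2.
split; apply: lim_Complex;
  [|exact/cvg_at_right_filter/free_continuous|exact/cvg_at_right_filter/free_continuous
  | |exact/cvg_at_right_filter/dfree_continuous|exact/cvg_at_right_filter/dfree_continuous];
  by apply: filterS (near_right_piece R kp) => x /(uv kp)[].
Qed.

Lemma lim_left k : (k < p)%N ->
  lim (u x @[x --> k%:R^'-]) = cfree z (k%:R - 1) (X k) (Y k) k%:R /\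
  lim (v x @[x --> k%:R^'-]) = dcfree z (k%:R - 1) (X k) (Y k) k%:R.
Proof.
move=> kp.
split; apply: lim_Complex;
  [|exact/cvg_at_left_filter/free_continuous|exact/cvg_at_left_filter/free_continuous
  | |exact/cvg_at_left_filter/dfree_continuous|exact/cvg_at_left_filter/dfree_continuous];
  by apply: filterS (near_left_piece R kp) => x /(uv (ltnW kp))[].
Qed.

Lemma lim_start :
  lim (u x @[x --> (- 2^-1)^'+]) = cfree z (- 1) (X 0) (Y 0) (- 2^-1) /\
  lim (v x @[x --> (- 2^-1)^'+]) = dcfree z (- 1) (X 0) (Y 0) (- 2^-1).
Proof.
have E : -1 = 0%:R - 1 :> R by rewrite sub0r.
split; apply: lim_Complex;
  [|exact/cvg_at_right_filter/free_continuous|exact/cvg_at_right_filter/free_continuous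
  | |exact/cvg_at_right_filter/dfree_continuous|exact/cvg_at_right_filter/dfree_continuous]; rewrite E;
  by apply: filterS (near_right_cell R p0) => x /(uv (leq0n _))[].
Qed.

Lemma lim_end :
  lim (u x @[x --> (p%:R - 2^-1)^'-]) =
    cfree z (p%:R - 1) (X p) (Y p) (p%:R - 2^-1) /\
  lim (v x @[x --> (p%:R - 2^-1)^'-]) =
    dcfree z (p%:R - 1) (X p) (Y p) (p%:R - 2^-1).
Proof.
split; apply: lim_Complex;
  [|exact/cvg_at_left_filter/free_continuous|exact/cvg_at_left_filter/free_continuous
  | |exact/cvg_at_left_filter/dfree_continuous|exact/cvg_at_left_filter/dfree_continuous];
  by apply: filterS (near_left_cell R p0) => x /(uv (leqnn _))[].
Qed.
End Limits.

(** The boundary conditions are imposed at half-integers. The half-step propagator is invertible, so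
    they can be moved back to the anchors [-1] and [p - 1]. *)
Lemma free_half_inj (sg z e e' : R) X X' :
  sg * free z e X (e + 2^-1) = free z e' X' (e' + 2^-1) ->
  sg * dfree z e X (e + 2^-1) = dfree z e' X' (e' + 2^-1) ->
  sg *: X = X'.
Proof.
rewrite /free /dfree ![_ + _ - _]addrAC !subrr !add0r.
have := cprop2_sprop2 z 2^-1; move: (cprop _ _) (sprop _ _) => c s cs h1 h2.
rewrite [RHS]surjective_pairing; congr pair.
- transitivity (c * (sg * (X.1 * c + X.2 * s)) - s * (sg * (- z * X.1 * s + X.2 * c))).
    by rewrite -[LHS]mul1r -cs /GRing.scale/=; ring.
  by rewrite h1 h2 -[RHS]mul1r -cs; ring.
- transitivity (z * s * (sg * (X.1 * c + X.2 * s)) + c * (sg * (- z * X.1 * s + X.2 * c))).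
    by rewrite -[LHS]mul1r -cs /GRing.scale/=; ring.
  by rewrite h1 h2 -[RHS]mul1r -cs; ring.
Qed.

(** Since [expi theta] is the real number [sg], real and imaginary parts decouple. The jump at [k]
    turns the state of piece [k] into that of piece [k + 1], and the boundary condition becomes a
    fixed-point equation. *)
Lemma eigenspace_states p (a : nat -> R) theta (sg : R) z u : (0 < p)%N ->
  expi theta = (sg%:C)%C ->
  qp_eigenspace (fun k : 'I_p => a k) theta z u ->
  exists X Y, [/\ X = sg *: sol a z X p, Y = sg *: sol a z Y p &
    forall k x, (k <= p)%N -> piece p k x ->
      u x = cfree z (k%:R - 1) (sol a z X k) (sol a z Y k) x].
Proof.
move=> p0 Esg [v [w [[Lu Lv Lw uv vw] jump bu bv wE]]].
have mU : measurable (@cell R p `\` @Zset R) 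
  by exact: (open_measurable (@open_cellZ R p)).
have [mvr mvi vfin] := Lv; have [mwr mwi wfin] := Lw.
have vfin' : (\int[mu]_(x in @cell R p `\` @Zset R)
   (complex.Im (v x) ^+ 2 + complex.Re (v x) ^+ 2)%:E < +oo)%E.
  by under eq_integral do rewrite addrC.
have wfin' : (\int[mu]_(x in @cell R p `\` @Zset R)
   (complex.Im (w x) ^+ 2 + complex.Re (w x) ^+ 2)%:E < +oo)%E.
  by under eq_integral do rewrite addrC.
have [|||||X XP] := @real_states p z (fun x => complex.Re (u x))
  (fun x => complex.Re (v x)) (fun x => complex.Re (w x)) p0.
- by move=> x y sub; exact: L2_integrable mvr mvi vfin sub.
- by move=> x y sub; exact: L2_integrable mwr mwi wfin sub.
- move=> x y xy sub; have := uv _ _ xy sub.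
  by case: (u x) (u y) => [? ?] [? ?] [].
- move=> x y xy sub; have := vw _ _ xy sub.
  by case: (v x) (v y) => [? ?] [? ?] [].
- apply: (filterS (F := almost_everywhere mu)) wE => t h ct; have := h ct.
  by case: (w t) (u t) => [? ?] [? ?] [/=]; rewrite mul0r subr0 => /eqP; rewrite eq_sym eqr_oppLR -mulNr => /eqP.
have [|||||Y YP] := @real_states p z (fun x => complex.Im (u x))
  (fun x => complex.Im (v x)) (fun x => complex.Im (w x)) p0.
- by move=> x y sub; exact: L2_integrable mvi mvr vfin' sub.
- by move=> x y sub; exact: L2_integrable mwi mwr wfin' sub.
- move=> x y xy sub; have := uv _ _ xy sub.
  by case: (u x) (u y) => [? ?] [? ?] [].
- move=> x y xy sub; have := vw _ _ xy sub.
  by case: (v x) (v y) => [? ?] [? ?] [].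
- apply: (filterS (F := almost_everywhere mu)) wE => t h ct; have := h ct.
  by case: (w t) (u t) => [? ?] [? ?] [/= _]; rewrite mul0r addr0 => /eqP; rewrite eq_sym eqr_oppLR -mulNr => /eqP.
have uvP k x : (k <= p)%N -> piece p k x ->
    u x = cfree z (k%:R - 1) (X k) (Y k) x /\ v x = dcfree z (k%:R - 1) (X k) (Y k) x.
  move=> kp kx; have [h1 h2] := XP k x kp kx; have [h3 h4] := YP k x kp kx.
  split; apply/eqP; rewrite eq_complex/=; apply/andP; split; apply/eqP; assumption.
have stepXY k : (k < p)%N ->
    X k.+1 = step (a k) z (X k) /\ Y k.+1 = step (a k) z (Y k).
  move=> kp; have [] := jump (Ordinal kp).
  have /= [-> ->] := lim_right uvP kp; have /= [-> ->] := lim_left uvP kp.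
  have [E1 E2] := free_step z k (X k); have [E3 E4] := free_step z k (Y k).
  rewrite /cfree /dcfree E1 E2 E3 E4 => -[] h1 h2 [].
  rewrite !mul0r subr0 addr0 h1 h2 => /eqP + /eqP.
  rewrite !subr_eq => /eqP h3 /eqP h4.
  rewrite [X k.+1]surjective_pairing [Y k.+1]surjective_pairing h1 h2 h3 h4.
  by split; congr pair; rewrite addrC.
have solXY k : (k <= p)%N -> X k = sol a z (X 0%N) k /\ Y k = sol a z (Y 0%N) k.
  elim: k => // k IH kp; have [-> ->] := stepXY k kp.
  by have [e1 e2] := IH (ltnW kp); rewrite /= -e1 -e2.
exists (X 0%N), (Y 0%N).
have [Xp Yp] := solXY p (leqnn _); rewrite -Xp -Yp.
have [s1 s2] := lim_start p0 uvP; have [e1 e2] := lim_end p0 uvP.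
have hs : - 2^-1 = -1 + 2^-1 :> R by lra.
have he : p%:R - 2^-1 = (p%:R - 1) + 2^-1 :> R by lra.
have [bX bY] : sg *: X p = X 0%N /\ sg *: Y p = Y 0%N.
  move: bu bv; rewrite s1 s2 e1 e2 Esg /cfree /dcfree he hs => -[].
  rewrite !mul0r !subr0 !addr0 => h1 h2 [].
  rewrite !mul0r subr0 addr0 => h3 h4.
  by split; [exact: free_half_inj (esym h1) (esym h3)|exact: free_half_inj (esym h2) (esym h4)].
split => // k x kp kx; have [<- <-] := solXY k kp.
by have [] := uvP k x kp kx.
Qed.
End EigenfunctionStates.

(** * From states to eigenfunctions *)

Section PiecewiseFunctions.
Variable R : realType.
Local Notation mu := (@lebesgue_measure R).
Implicit Types (x y z : R) (k p : nat) (X : R * R).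

Definition pw (F : nat -> R -> R) x : R := F (Num.truncn (x + 1)) x.

Lemma pw_piece (F : nat -> R -> R) p k x : piece p k x -> pw F x = F k x.
Proof. by move=> kx; rewrite /pw (truncn_piece kx). Qed.

Lemma near_piece p k x : piece p k x -> \forall y \near x, piece p k y.
Proof.
move=> [x1 x2 x3 x4]; near=> y; split; near: y;
  [exact: lt_nbhsr|exact: lt_nbhsl|exact: lt_nbhsr|exact: lt_nbhsl].
Unshelve. all: by end_near. Qed.

Lemma pw_measurable (F : nat -> R -> R) p : (forall k, continuous (F k)) ->
  measurable_fun (@cell R p `\` @Zset R) (pw F).
Proof.
move=> cF; apply: open_continuous_measurable_fun; first exact: open_cellZ.
move=> x; rewrite inE => /cellZ_piece[]; set k := Num.truncn _ => kx _.
rewrite /continuous_at (pw_piece F kx).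
have h := cF k x; apply: (cvg_trans _ h); apply: near_eq_cvg.
by apply: filterS (near_piece kx) => y ky; rewrite (pw_piece F ky).
Qed.

Lemma pw_bounded (F : nat -> R -> R) p : (forall k, continuous (F k)) ->
  exists M, forall x, (@cell R p `\` @Zset R) x -> `|pw F x| <= M.
Proof.
move=> cF.
have /choice[M MP] : forall k, exists M : R, forall x, piece p k x -> `|F k x| <= M.
  move=> k; have cFk : {within `[k%:R - 1, k%:R], continuous (F k)}.
    exact: continuous_subspaceT.
  have := continuous_compact cFk (@segment_compact _ _ _).
  move=> /compact_bounded[M [_ MF]]; exists (M + 1) => x [x1 x2 x3 x4].
  by apply: (MF (M + 1)); rewrite ?ltrDl//; exists x => //=; rewrite in_itv/= !ltW.
exists (\sum_(k < p.+1) `|M k|) => x /cellZ_piece[]; set k := Num.truncn _ => kx kp.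
rewrite (pw_piece F kx) (le_trans (MP k x kx))// (le_trans (ler_norm _))//.
have kp' : (k < p.+1)%N by [].
by rewrite (bigD1 (Ordinal kp'))//= lerDl sumr_ge0.
Qed.

Lemma pw_L2 (F : nat -> R -> R) p : (forall k, continuous (F k)) ->
  L2 (@cell R p `\` @Zset R) (fun x => Complex (pw F x) 0).
Proof.
move=> cF; have mF := @pw_measurable F p cF; split; [exact: mF|exact: measurable_cst|].
have [M MF] := @pw_bounded F p cF.
pose U : set (measurableTypeR R) := @cell R p `\` @Zset R.
have mU : measurable U by exact: measurable_cellZ.
have mF2 : measurable_fun U (fun x => pw F x ^+ 2 + 0 ^+ 2).
  apply: measurable_funD; last exact: measurable_cst.
  by apply: measurable_funX; exact: mF.
have : mu.-integrable U (EFin \o (fun x => pw F x ^+ 2 + 0 ^+ 2)).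
  apply: measurable_bounded_integrable => //.
    apply: (@le_lt_trans _ _ (mu (@cell R p))).
      apply: le_measure; rewrite ?inE//; first exact: measurable_itv.
      by move=> x [].
    by rewrite lebesgue_measure_itv/=; case: ifP => // _; rewrite -EFinB ltry.
  exists (M ^+ 2); split; first by rewrite num_real.
  move=> y My x Ux; rewrite expr0n/= addr0 ger0_norm ?sqr_ge0//.
  rewrite (le_trans _ (ltW My))// -[leLHS]real_normK ?num_real//.
  by have h := MF x Ux; rewrite ler_sqr ?nnegrE// (le_trans _ h).
case/integrableP => _.
by under eq_integral => t _ do rewrite /= ger0_norm ?addr_ge0 ?sqr_ge0//.
Qed.

Lemma pw_primitive (F G : nat -> R -> R) p x y :
  (forall k x, is_derive x 1 (F k) (G k x)) -> (forall k, continuous (G k)) ->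
  x <= y -> `[x, y] `<=` @cell R p `\` @Zset R ->
  pw F y - pw F x = \int[mu]_(t in `[x, y]) pw G t.
Proof.
move=> dF cG xy sub; have [k kp [kx ky]] := itv_piece xy sub.
rewrite (pw_piece F kx) (pw_piece F ky).
have -> : \int[mu]_(t in `[x, y]) pw G t = \int[mu]_(t in `[x, y]) G k t.
  apply: eq_Rintegral => t; rewrite inE => /(piece_itv kx ky) kt.
  exact: (pw_piece G kt).
have cFk : continuous (F k).
  by move=> t; exact: is_derive_continuous (dF k t).
move: xy; rewrite le_eqVlt => /predU1P[<-|xy].
  by rewrite subrr set_itv1 Rintegral_set1.
rewrite /Rintegral (@continuous_FTC2 _ (G k) (F k))//.
- exact: continuous_subspaceT.
- split.
  + by move=> t _; exact: (ex_derive (is_derive := dF k t)).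
  + exact/cvg_at_right_filter/cFk.
  + exact/cvg_at_left_filter/cFk.
- by move=> t _; rewrite derive1E; exact: (derive_val (is_derive := dF k t)).
Qed.

Lemma pw_primitive_on (F G : nat -> R -> R) p :
  (forall k x, is_derive x 1 (F k) (G k x)) -> (forall k, continuous (G k)) ->
  primitive_on (@cell R p `\` @Zset R)
    (fun x => Complex (pw F x) 0) (fun x => Complex (pw G x) 0).
Proof.
move=> dF cG x y xy sub; rewrite /Cintegral/= -(pw_primitive dF cG xy sub).
rewrite (_ : Rintegral _ _ (fun=> 0) = 0).
  by apply/eqP; rewrite eq_complex/= subrr !eqxx.
by rewrite /Rintegral integral0.
Qed.

Definition eigenfun (a : nat -> R) z X : R -> R :=
  pw (fun k => free z (k%:R - 1) (sol a z X k)).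

Lemma states_eigenspace p (a : nat -> R) theta (sg : R) z X : (0 < p)%N ->
  expi theta = (sg%:C)%C -> X = sg *: sol a z X p ->
  qp_eigenspace (fun k : 'I_p => a k) theta z (fun x => Complex (eigenfun a z X x) 0).
Proof.
move=> p0 Esg Xp.
pose F k := free z (k%:R - 1) (sol a z X k).
pose G k := dfree z (k%:R - 1) (sol a z X k).
pose H k x := - z * F k x.
have dF k x : is_derive x 1 (F k) (G k x) by exact: is_derive_free.
have dG k x : is_derive x 1 (G k) (H k x) by exact: is_derive_dfree.
have cF k : continuous (F k) by exact: free_continuous.
have cG k : continuous (G k) by exact: dfree_continuous.
have cH k : continuous (H k) by move=> x; apply: cvgM; [exact: cvg_cst|exact: cF].
pose u x : R[i] := Complex (pw F x) 0; pose v x : R[i] := Complex (pw G x) 0.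
(* The imaginary state is zero, so the one-sided limits computed for complex functions apply. *)
have uvP k x : (k <= p)%N -> piece p k x ->
    u x = cfree z (k%:R - 1) (sol a z X k) (0, 0) x /\
    v x = dcfree z (k%:R - 1) (sol a z X k) (0, 0) x.
  move=> _ kx; rewrite /u /v (pw_piece F kx) (pw_piece G kx) /cfree /dcfree.
  by rewrite /free /dfree /= !mulr0 !mul0r !addr0.
have hs : - 2^-1 - -1 = 2^-1 :> R by lra.
have he : p%:R - 2^-1 - (p%:R - 1) = 2^-1 :> R by lra.
have bF : free z (-1) X (- 2^-1) = sg * free z (p%:R - 1) (sol a z X p) (p%:R - 2^-1).
  by rewrite {1}Xp /free hs he /= /GRing.scale/=; ring.
have bG : dfree z (-1) X (- 2^-1) = sg * dfree z (p%:R - 1) (sol a z X p) (p%:R - 2^-1).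
  by rewrite {1}Xp /dfree hs he /= /GRing.scale/=; ring.
exists v, (fun x => Complex (pw H x) 0); split.
- split; [exact: pw_L2|exact: pw_L2|exact: pw_L2| |].
  + exact: pw_primitive_on.
  + exact: pw_primitive_on.
- move=> k; have kp := ltn_ord k.
  have /= [-> ->] := lim_right (Y := fun=> (0, 0)) uvP kp.
  have /= [-> ->] := lim_left (Y := fun=> (0, 0)) uvP kp.
  rewrite /cfree /dcfree.
  have [E1 E2] := free_step z k (sol a z X k); have [E3 E4] := free_step z k (0, 0).
  rewrite E1 E2 E3 E4 /= !mulr0 !addr0; split => //.
  by apply/eqP; rewrite eq_complex/= !(mulr0, mul0r, subr0, addr0) eqxx andbT; apply/eqP; ring.
- have [-> _] := lim_start p0 (Y := fun=> (0, 0)) uvP.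
  have [-> _] := lim_end p0 (Y := fun=> (0, 0)) uvP.
  rewrite Esg /cfree bF /free /=; apply/eqP.
  by rewrite eq_complex/= !(mulr0, mul0r, addr0, subr0) !eqxx.
- have [_ ->] := lim_start p0 (Y := fun=> (0, 0)) uvP.
  have [_ ->] := lim_end p0 (Y := fun=> (0, 0)) uvP.
  rewrite Esg /dcfree bG /dfree /=; apply/eqP.
  by rewrite eq_complex/= !(mulr0, mul0r, addr0, subr0) !eqxx.
- apply: aeW => x _; apply/eqP; rewrite eq_complex/=.
  by rewrite !(mulr0, mul0r, addr0, subr0) oppr0 eqxx andbT /pw /H mulNr opprK.
Qed.
End PiecewiseFunctions.

(** * Multiplicities *)

Section AeDimension.
Variable R : realType.
Local Notation mu := (@lebesgue_measure R).
Implicit Types (D : set R) (E : set (R -> R[i])) (u : R -> R[i]).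

Lemma ae_dim_eq0 D E : (forall u, E u -> ae_eq mu D u (cst 0)) ->
  forall n, ae_dim D E n <-> n = 0%N.
Proof.
move=> E0 n; split=> [[e [Ee free_e _]]|->].
  case: n e Ee free_e => // n e Ee free_e.
  have := free_e (fun i => (i == ord0)%:R).
  have e00 := E0 _ (Ee ord0).
  have h : ae_eq mu D (fun x => \sum_i (i == ord0)%:R * e i x) (cst 0).
    apply: (filterS (F := almost_everywhere mu)) e00 => x h Dx.
    rewrite (bigD1 ord0)// eqxx mul1r (h Dx) /= add0r big1// => i /negPf ->.
    by rewrite mul0r.
  by move=> /(_ h ord0) /eqP; rewrite eqxx oner_eq0.
exists (fun=> cst 0); split => [[]//|c _ []//|u Eu].
exists (fun=> 0); apply: (filterS (F := almost_everywhere mu)) (E0 _ Eu) => x h Dx.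
by rewrite h// big_ord0.
Qed.

Lemma ae_dim_eq1 D E (e0 : R -> R[i]) : E e0 -> ~ ae_eq mu D e0 (cst 0) ->
  (forall u, E u -> exists c : R[i], ae_eq mu D u (fun x => c * e0 x)) ->
  forall n, ae_dim D E n <-> n = 1%N.
Proof.
move=> Ee0 e0N0 span n; split=> [[e [Ee free_e gen]]|->].
  case: n e Ee free_e gen => [|[|n]] // e Ee free_e gen.
    exfalso; apply: e0N0; have [c h] := gen _ Ee0.
    by apply: (filterS (F := almost_everywhere mu)) h => x h Dx; rewrite h// big_ord0.
  pose i1 : 'I_n.+2 := lift ord0 ord0.
  have [c0 h0] := span _ (Ee ord0); have [c1 h1] := span _ (Ee i1).
  have sumE (c : 'I_n.+2 -> R[i]) x : (forall i, i != ord0 -> i != i1 -> c i = 0) ->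
      \sum_i c i * e i x = c ord0 * e ord0 x + c i1 * e i1 x.
    move=> c_0; rewrite (bigD1 ord0)//= (bigD1 i1)//= big1 ?addr0// => i /andP[i0 i_1].
    by rewrite c_0// mul0r.
  (* Two multiples [c0 e0] and [c1 e0] satisfy the relation with coefficients [c1] and [- c0];
     freeness then gives [c0 = 0], so the first basis element would vanish. *)
  pose c i : R[i] := if i == ord0 then c1 else if i == i1 then - c0 else 0.
  have hc : ae_eq mu D (fun x => \sum_i c i * e i x) (cst 0).
    apply: (filterS2 (F := almost_everywhere mu)) h0 h1 => x g0 g1 Dx.
    rewrite sumE => [|i /negPf i0 /negPf i_1]; last by rewrite /c i0 i_1.
    by rewrite /c !eqxx /= g0// g1//; ring.
  have c00 : c0 = 0.
    have /eqP := free_e _ hc i1; rewrite /c eqxx /=.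
    by rewrite oppr_eq0 => /eqP.
  have := free_e (fun i => (i == ord0)%:R).
  have h : ae_eq mu D (fun x => \sum_i (i == ord0)%:R * e i x) (cst 0).
    apply: (filterS (F := almost_everywhere mu)) h0 => x h Dx.
    rewrite (bigD1 ord0)// eqxx mul1r (h Dx) c00 /= mul0r add0r big1// => i /negPf ->.
    by rewrite mul0r.
  by move=> /(_ h ord0) /eqP; rewrite eqxx oner_eq0.
exists (fun=> e0); split => // [c h i|u /span[c h]].
  rewrite ord1; apply/eqP/negPn/negP => c0; apply: e0N0.
  apply: (filterS (F := almost_everywhere mu)) h => x /[apply].
  rewrite big_ord1 => /eqP; rewrite mulf_eq0 (negPf c0)/= => /eqP //.
exists (fun=> c); apply: (filterS (F := almost_everywhere mu)) h => x h Dx.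
by rewrite big_ord1 h.
Qed.

Lemma ae_eq_pieces p u (e0 : R -> R[i]) :
  (forall x, (@cell R p `\` @Zset R) x -> u x = e0 x) -> ae_eq mu (@cell R p) u e0.
Proof.
move=> ue; have Z0 : mu (@Zset R) = 0%E by exact/countable_lebesgue_measure0/countable_Zset.
have mZ : measurable (@Zset R : set (measurableTypeR R)).
  apply: countable_measurable; last exact: countable_Zset.
  by move=> t; exact: measurable_set1.
exists (@Zset R); split => // x /= h; apply: contrapT => xZ; apply: h => cx.
exact: ue.
Qed.

Lemma ae_zero_continuous (f : R -> R) a b : continuous f ->
  {ae mu, forall x, a < x -> x < b -> f x = 0} -> forall x, a < x -> x < b -> f x = 0.
Proof.
move=> cf [N [mN N0 sN]] x ax xb; apply/eqP/negPn/negP => fx.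
have : \forall y \near x, f y != 0 by exact: cvgr_neq0 (cf x) fx.
have xI : x \in `]a, b[ by rewrite in_itv/= ax xb.
move=> /(filterI (near_in_itvoo xI)) /nbhs_ballP[e /= e0 he].
have sub : `]x, x + e[ `<=` N.
  move=> y; rewrite /= in_itv/= => /andP[xy ye]; apply: sN => /= h.
  have [] := he y.
    by rewrite /ball/= distrC ger0_norm; lra.
  by rewrite in_itv/= => /andP[ay yb] /eqP; apply; exact: h.
have : (mu `]x, (x + e)%R[ <= mu N)%E.
  by apply: le_measure => //; rewrite inE//; exact: measurable_itv.
rewrite N0 lebesgue_measure_itv/= lte_fin ltrDl e0 -EFinB lee_fin.
by rewrite addrC addKr leNgt e0.
Qed.
End AeDimension.

Section Kernel.
Variable R : realType.
Implicit Types (a : nat -> R) (z sg : R) (X : R * R).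

Lemma sol0 a z k : sol a z (0, 0) k = (0, 0).
Proof. by elim: k => //= k ->; rewrite /step/= !(mulr0, addr0). Qed.

Lemma sol_fixedP a z sg p X : X = sg *: sol a z X p <->
  (sg * (sol a z (1, 0) p).1 - 1) * X.1 + sg * (sol a z (0, 1) p).1 * X.2 = 0 /\
  sg * (sol a z (1, 0) p).2 * X.1 + (sg * (sol a z (0, 1) p).2 - 1) * X.2 = 0.
Proof.
have [h1 h2] := sol_lin a z X p.
have -> : (sg * (sol a z (1, 0) p).1 - 1) * X.1 + sg * (sol a z (0, 1) p).1 * X.2 =
    sg * (sol a z X p).1 - X.1 by rewrite h1; ring.
have -> : sg * (sol a z (1, 0) p).2 * X.1 + (sg * (sol a z (0, 1) p).2 - 1) * X.2 =
    sg * (sol a z X p).2 - X.2 by rewrite h2; ring.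
split=> [XE|[/eqP + /eqP]].
  have E1 : X.1 = sg * (sol a z X p).1 by rewrite {1}XE.
  have E2 : X.2 = sg * (sol a z X p).2 by rewrite {1}XE.
  by rewrite -E1 -E2 !subrr.
rewrite !subr_eq0 => /eqP e1 /eqP e2.
by rewrite [LHS]surjective_pairing -e1 -e2.
Qed.

Lemma sol_fixed0 a z sg p X : sg ^+ 2 = 1 -> discr a p z != 2 * sg ->
  X = sg *: sol a z X p -> X = (0, 0).
Proof.
move=> sg2 D /sol_fixedP[]; have det := sol_det a z p; move: D; rewrite /discr.
move: (sol a z (1, 0) p).1 (sol a z (1, 0) p).2 det => A C.
move: (sol a z (0, 1) p).1 (sol a z (0, 1) p).2 => B E det D h1 h2.
have d0 : 2 - sg * (A + E) != 0.
  apply: contraNneq D => h; apply/eqP.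
  transitivity (sg ^+ 2 * (A + E)); first by rewrite sg2 mul1r.
  have h' : sg * (A + E) = 2 by lra.
  by rewrite expr2 -mulrA h' mulrC.
(* The determinant of [sg T - 1], where [T] is the transfer matrix; Cramer's rule follows. *)
have dE : (sg * A - 1) * (sg * E - 1) - sg * B * (sg * C) = 2 - sg * (A + E).
  transitivity (sg ^+ 2 * (A * E - C * B) + 1 - sg * (A + E)); first by ring.
  by rewrite sg2 det; ring.
have e1 : (2 - sg * (A + E)) * X.1 = 0.
  rewrite -dE; transitivity ((sg * E - 1) * ((sg * A - 1) * X.1 + sg * B * X.2) -
    sg * B * (sg * C * X.1 + (sg * E - 1) * X.2)); first by ring.
  by rewrite h1 h2 !mulr0 subrr.
have e2 : (2 - sg * (A + E)) * X.2 = 0.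
  rewrite -dE; transitivity ((sg * A - 1) * (sg * C * X.1 + (sg * E - 1) * X.2) -
    sg * C * ((sg * A - 1) * X.1 + sg * B * X.2)); first by ring.
  by rewrite h1 h2 !mulr0 subrr.
move/eqP: e1; move/eqP: e2; rewrite !mulf_eq0 !(negbTE d0)/= => /eqP X2 /eqP X1.
by rewrite [LHS]surjective_pairing X1 X2.
Qed.

Lemma kernel_line (m n x y : R) : (m, n) != (0, 0) -> m * x + n * y = 0 ->
  (x, y) = ((n * x - m * y) / (m ^+ 2 + n ^+ 2)) *: (n, - m).
Proof.
move=> mn0 h.
have d0 : m ^+ 2 + n ^+ 2 != 0.
  apply: contraNneq mn0 => /eqP; rewrite paddr_eq0 ?sqr_ge0// !sqrf_eq0.
  by move=> /andP[/eqP -> /eqP ->].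
congr pair; apply: (mulfI d0); rewrite /GRing.scale/=.
- transitivity (n * (n * x - m * y) + m * (m * x + n * y)); first by ring.
  by rewrite h mulr0 addr0; field.
- transitivity (- m * (n * x - m * y) + n * (m * x + n * y)); first by ring.
  by rewrite h mulr0 addr0; field.
Qed.

(** On this level [sg T - 1] is singular but not zero. Either row that is nonzero determines a line,
    and singularity makes the other row vanish on it. *)
Lemma sol_fixed_line a z sg p : sg ^+ 2 = 1 -> discr a p z = 2 * sg ->
  ~ (sol a z (1, 0) p = (sg, 0) /\ sol a z (0, 1) p = (0, sg)) ->
  exists X, [/\ X != (0, 0), X = sg *: sol a z X p &
    forall Y, Y = sg *: sol a z Y p -> exists t : R, Y = t *: X].
Proof.
move=> sg2 D nI.
pose A := (sol a z (1, 0) p).1; pose C := (sol a z (1, 0) p).2.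
pose B := (sol a z (0, 1) p).1; pose E := (sol a z (0, 1) p).2.
have det : A * E - C * B = 1 := sol_det a z p.
have dE : (sg * A - 1) * (sg * E - 1) = sg * B * (sg * C).
  transitivity (sg ^+ 2 * (A * E - C * B) + 1 - sg * (A + E) + sg * B * (sg * C)).
    by ring.
  by rewrite -/(discr a p z) D det mulrCA -expr2 sg2; ring.
have [r1|r1] := eqVneq (sg * A - 1, sg * B) (0, 0); last first.
  exists (sg * B, - (sg * A - 1)); split.
  - by apply: contraNneq r1 => -[-> /eqP]; rewrite oppr_eq0 => /eqP ->.
  - apply/sol_fixedP; rewrite -/A -/B -/C -/E /=; split; first by ring.
    by rewrite mulrN [X in _ - X]mulrC dE; ring.
  - move=> Y /sol_fixedP[h _]; have := kernel_line r1 h.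
    by rewrite -surjective_pairing => YE; eexists; exact: YE.
have [r2|r2] := eqVneq (sg * C, sg * E - 1) (0, 0); last first.
  exists (sg * E - 1, - (sg * C)); split.
  - by apply: contraNneq r2 => -[-> /eqP]; rewrite oppr_eq0 => /eqP ->.
  - apply/sol_fixedP; rewrite -/A -/B -/C -/E /=; split; last by ring.
    by rewrite dE; ring.
  - move=> Y /sol_fixedP[_ h]; have := kernel_line r2 h.
    by rewrite -surjective_pairing => YE; eexists; exact: YE.
exfalso; apply: nI; case: r1 r2 => /eqP + /eqP + [/eqP + /eqP].
have sg0 : sg != 0 by apply: contra_eq_neq sg2 => ->; rewrite expr0n/= eq_sym oner_eq0.
rewrite !mulf_eq0 !(negbTE sg0)/= !subr_eq0 => /eqP hA /eqP hB /eqP hC /eqP hE.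
split; rewrite [LHS]surjective_pairing -/A -/B -/C -/E ?hB ?hC; congr pair.
- by rewrite -[LHS]mul1r -sg2 expr2 -mulrA hA mulr1.
- by rewrite -[LHS]mul1r -sg2 expr2 -mulrA hE mulr1.
Qed.
End Kernel.

(** * Eigenvalues and gaps *)

Section Eigenvalues.
Variable R : realType.
Local Notation mu := (@lebesgue_measure R).
Implicit Types (a : nat -> R) (z sg theta : R) (X : R * R).

Lemma free0 z e x : free z e (0, 0) x = 0.
Proof. by rewrite /free !mul0r addr0. Qed.

Lemma eigenfun0 a z x : eigenfun a z (0, 0) x = 0.
Proof. by rewrite /eigenfun /pw sol0 free0. Qed.

Lemma solZ a z (t : R) X k : sol a z (t *: X) k = t *: sol a z X k.
Proof.
have [h1 h2] := sol_lin a z (t *: X) k; have [g1 g2] := sol_lin a z X k.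
rewrite [LHS]surjective_pairing h1 h2 [RHS]surjective_pairing /= g1 g2.
by rewrite /GRing.scale/= !mulrDr !mulrA.
Qed.

Lemma eigenfunZ a z (t : R) X x : eigenfun a z (t *: X) x = t * eigenfun a z X x.
Proof.
rewrite /eigenfun /pw solZ /free /=; move: (sol _ _ _ _) (cprop _ _) (sprop _ _) => Y c s.
by rewrite /GRing.scale/= mulrDr !mulrA.
Qed.

Lemma eigenfun_neq0 a z p X : (0 < p)%N -> X != (0, 0) ->
  ~ ae_eq mu (@cell R p) (fun x => Complex (eigenfun a z X x) 0) (cst 0).
Proof.
move=> p0 X0 h; have p1 : 1 <= p%:R :> R by rewrite ler1n.
have f0 x : - 2^-1 < x -> x < 0 -> free z (-1) X x = 0.
  apply: ae_zero_continuous; first exact: free_continuous.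
  apply: (filterS (F := almost_everywhere mu)) h => t h t1 t2.
  have pt : piece p 0 t by split; lra.
  have [ct _] := piece_sub pt.
  by have := h ct; rewrite /eigenfun (pw_piece _ pt) /= sub0r => -[].
(* An interior point of the first half-piece: value and derivative both vanish there, and the
   propagator is invertible. *)
pose x0 : R := - 4^-1.
have x1 : - 2^-1 < x0 by rewrite /x0; lra.
have x2 : x0 < 0 by rewrite /x0; lra.
have d0 : dfree z (-1) X x0 = 0.
  have dF := is_derive_free z (-1) X x0.
  have dF0 : is_derive x0 1 (free z (-1) X) 0.
    apply: (near_eq_is_derive _ (is_derive_cst (0 : R) x0 1)).
    by apply: near_itvoo x1 x2 _ => y y1 y2; rewrite f0.
  by rewrite -(derive_val (is_derive := dF)) (derive_val (is_derive := dF0)).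
have := f0 x0 x1 x2; move: d0; rewrite /free /dfree.
have := cprop2_sprop2 z (x0 - -1); move: (cprop _ _) (sprop _ _) => c s cs h1 h2.
move/eqP: X0; apply; rewrite [LHS]surjective_pairing; congr pair.
- transitivity ((c ^+ 2 + z * s ^+ 2) * X.1); first by rewrite cs mul1r.
  transitivity (c * (X.1 * c + X.2 * s) - s * (- z * X.1 * s + X.2 * c)); first by ring.
  by rewrite h1 h2 !mulr0 subrr.
- transitivity ((c ^+ 2 + z * s ^+ 2) * X.2); first by rewrite cs mul1r.
  transitivity (z * s * (X.1 * c + X.2 * s) + c * (- z * X.1 * s + X.2 * c)); first by ring.
  by rewrite h1 h2 !mulr0 addr0.
Qed.

(** The transfer matrix is [sg] times the identity: every state satisfies the boundary condition,
    and [z] is a double eigenvalue. *)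
Definition monodromy_scalar a p z sg :=
  sol a z (1, 0) p = (sg, 0) /\ sol a z (0, 1) p = (0, sg).

(** Outside the scalar case the fixed states are zero or form a real line, so at most one real
    eigenfunction spans the complex eigenspace. The boolean is read as 0 or 1. *)
Lemma qp_eigenspace_dim a p theta sg z : (0 < p)%N ->
  expi theta = (sg%:C)%C -> sg ^+ 2 = 1 -> ~ monodromy_scalar a p z sg ->
  forall n, ae_dim (@cell R p) (qp_eigenspace (fun k : 'I_p => a k) theta z) n <->
    n = (discr a p z == 2 * sg) :> nat.
Proof.
move=> p0 Esg sg2 nI.
have span u : qp_eigenspace (fun k : 'I_p => a k) theta z u ->
    exists X Y, [/\ X = sg *: sol a z X p, Y = sg *: sol a z Y p &
      ae_eq mu (@cell R p) u (fun x => Complex (eigenfun a z X x) (eigenfun a z Y x))].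
  move=> /(eigenspace_states p0 Esg)[X [Y [hX hY hu]]]; exists X, Y; split => //.
  apply: ae_eq_pieces => x /cellZ_piece[]; set k := Num.truncn _ => kx kp.
  by rewrite (hu k x kp kx) /eigenfun !(pw_piece _ kx).
have [D|D] := eqVneq; last first.
  apply: ae_dim_eq0 => u /span[X [Y [/(sol_fixed0 sg2 D) -> /(sol_fixed0 sg2 D) -> h]]].
  by apply: (filterS (F := almost_everywhere mu)) h => x /[apply] ->; rewrite !eigenfun0.
have [X [X0 XE XP]] := sol_fixed_line sg2 D nI.
apply: (@ae_dim_eq1 _ _ _ (fun x => Complex (eigenfun a z X x) 0)).
- exact: states_eigenspace p0 Esg XE.
- exact: eigenfun_neq0 p0 X0.
(* The real factors of the two parts combine into one complex coefficient. *)
- move=> u /span[X1 [Y1 [/XP[t ->] /XP[s ->] h]]]; exists (Complex t s).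
  apply: (filterS (F := almost_everywhere mu)) h => x /[apply] ->.
  by rewrite !eigenfunZ; apply/eqP; rewrite eq_complex/= !mulr0 subr0 add0r !eqxx.
Qed.

Lemma card_fiber (l : nat -> R) z n : {homo l : i j / (i < j)%N >-> i < j} ->
  n = `[< range l z >] :> nat <-> ([set j | l j = z] #= `I_n)%card.
Proof.
move=> li; have inj : injective l.
  by move=> i j lij; apply/eqP; case: ltngtP => // /li; rewrite lij ltxx.
have [[j _ jz]|nz] := asboolP.
  have -> : [set j | l j = z] = [set j].
    by apply/seteqP; split => i /=; [rewrite -jz => /inj|move=> ->].
  split=> [->|h]; first exact: card_set1.
  by move: h; rewrite (card_eql card_set1) => /card_eq_II <-.
have -> : [set j | l j = z] = set0.
  by apply/seteqP; split => // i /= iz; apply: nz; exists i.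
have I0 : `I_0 = set0 :> set nat by apply/seteqP; split.
split=> [->|h]; first by rewrite I0 card_eq00.
by move: h; rewrite -I0 => /card_eq_II <-.
Qed.

(** The eigenvalues are the points where [discr] equals [2 sg]: locally finite by [discr_simple],
    bounded below by [discr_gt2], unbounded above by [discr_unbounded_levels], and each of
    multiplicity one. *)
Lemma qp_eigenvalue_enum_exists a p theta (b : nat) : (0 < p)%N ->
  expi theta = (((-1) ^+ b)%:C)%C -> (forall z, ~ monodromy_scalar a p z ((-1) ^+ b)) ->
  exists l, qp_eigenvalue_enum (fun k : 'I_p => a k) theta l.
Proof.
move=> p0 Esg nI; set sg : R := (-1) ^+ b in Esg nI.
have sg2 : sg ^+ 2 = 1 by rewrite /sg sqrr_sign.
have simple z : discr a p z = 2 * sg -> exists2 d : R, is_derive z 1 (discr a p) d & d != 0.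
  by move=> D; apply: discr_simple D (nI z).
have [|||l li lr] := @increasing_enum R [set z | discr a p z = 2 * sg].
- have [M MD] := discr_gt2 a p0; exists M => z /= Dz; rewrite ltNge; apply/negP => /MD.
  rewrite Dz /sg -signr_odd; case: odd; rewrite ?expr0 ?expr1; lra.
- by move=> lo hi; apply: finite_level => //; exact: discr_continuous.
- by move=> M; have [z Mz Dz] := discr_unbounded_levels a b M p0; exists z.
exists l; split.
  by move=> i j; rewrite leq_eqVlt => /predU1P[->//|/li/ltW].
move=> z n; rewrite (qp_eigenspace_dim p0 Esg sg2 (nI z) n) -(card_fiber z n li) lr.
suff -> : `[< [set z | discr a p z = 2 * sg] z >] = (discr a p z == 2 * sg) by [].
by apply/asboolP/eqP.
Qed.

(** Equal consecutive eigenvalues would put two indices into one fiber, whose size is an eigenspace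
    dimension and hence at most 1. *)
Lemma qp_eigenvalue_lt a p theta (b : nat) j : (0 < p)%N ->
  expi theta = (((-1) ^+ b)%:C)%C -> (forall z, ~ monodromy_scalar a p z ((-1) ^+ b)) ->
  qp_eigenvalue (fun k : 'I_p => a k) theta j < qp_eigenvalue (fun k : 'I_p => a k) theta j.+1.
Proof.
move=> p0 Esg nI; have sg2 : ((-1) ^+ b : R) ^+ 2 = 1 by rewrite sqrr_sign.
(* As an enumeration exists, [xget] returns an enumeration and not the default zero sequence. *)
have [l0 l0P] := qp_eigenvalue_enum_exists p0 Esg nI.
have := @xgetI _ (fun=> 0) [set l | qp_eigenvalue_enum (fun k : 'I_p => a k) theta l] l0 l0P.
rewrite -/(qp_eigenvalue _ _); set l := qp_eigenvalue _ _ => -[lh ldim].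
rewrite lt_neqAle lh// andbT; apply/eqP => lE.
set z := l j in lE.
have := (qp_eigenspace_dim p0 Esg sg2 (nI z) _).2 erefl; move=> /(ldim z _).1.
case: (_ == _) => /=.
  move=> /card_set_bijP[f [fm fi _]].
  have fj : f j = 0%N by have := fm j erefl; rewrite /= ltnS leqn0 => /eqP.
  have fj1 : f j.+1 = 0%N by have := fm j.+1 (esym lE); rewrite /= ltnS leqn0 => /eqP.
  have : j = j.+1 by apply: fi; rewrite ?inE//= ?fj.
  by move/eqP; rewrite ltn_eqF.
have -> : `I_0 = set0 :> set nat by apply/seteqP; split.
rewrite card_eq0 => /eqP /seteqP[+ _] => /(_ j); exact.
Qed.

(** Both ends of gap [j] are consecutive eigenvalues for the same angle, 0 for odd [j] and [pi] for
    even [j]. *)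
Lemma all_gaps_open_monodromy p (alpha : periodic_seq R p) : (0 < p)%N ->
  (forall z (b : nat), ~ monodromy_scalar (fun k => alpha k%:Z) p z ((-1) ^+ b)) ->
  all_gaps_open alpha.
Proof.
move=> p0 nI j; pose a k := alpha k%:Z.
have h0 i : qp_eigenvalue (one_period alpha) 0 i < qp_eigenvalue (one_period alpha) 0 i.+1.
  apply: (@qp_eigenvalue_lt a p 0 0 i p0); last by move=> z; exact: nI.
  by rewrite expi0 expr0.
have hpi i : qp_eigenvalue (one_period alpha) pi i < qp_eigenvalue (one_period alpha) pi i.+1.
  apply: (@qp_eigenvalue_lt a p pi 1 i p0); last by move=> z; exact: nI.
  by rewrite expi_pi expr1; apply/eqP; rewrite eq_complex/= oppr0 !eqxx.
rewrite /gap /band_right /band_left /=.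
set u := qp_eigenvalue _ _ j; set v := qp_eigenvalue _ _ j.+1.
have uv : u < v by rewrite /u /v /=; case: (odd j) => /=.
by exists ((u + v) / 2); rewrite /= in_itv/=; lra.
Qed.
End Eigenvalues.

(** * Genericity *)

Section Generic.
Variable R : realType.
Local Notation mu := (@lebesgue_measure R).

(** * Shifting the last coupling *)

Section Perturbation.
Implicit Types (a b : nat -> R) (z t : R) (X : R * R).

Lemma eq_sol a b z X k : (forall i, (i < k)%N -> a i = b i) -> sol a z X k = sol b z X k.
Proof.
elim: k => //= k IH ab; rewrite ab// IH// => i ik; apply: ab.
exact: ltnW.
Qed.

Lemma sol_perturb a b z t X q : (forall i, (i < q)%N -> b i = a i) -> b q = a q + t ->
  sol b z X q.+1 =
    ((sol a z X q.+1).1, (sol a z X q.+1).2 + t * (sol a z X q.+1).1).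
Proof.
move=> ab bq; rewrite /= (eq_sol (b := a))// bq /step/=; congr pair; ring.
Qed.

(** Scalar monodromy forces [z] to be a zero of the upper right entry, which is independent of [t];
    the vanishing lower left entry then gives [t = g z]. *)
Lemma countable_scalar_perturbations a q :
  countable [set t | exists z (n : nat) b, [/\ forall i, (i < q)%N -> b i = a i,
    b q = a q + t & monodromy_scalar b q.+1 z ((-1) ^+ n)]].
Proof.
pose g z := - (sol a z (1, 0) q.+1).2 / (sol a z (1, 0) q.+1).1.
have cZ : countable [set z | (sol a z (0, 1) q.+1).1 = 0].
  apply: countable_level; first by have [] := sol_continuous a (0, 1) q.+1.
  by move=> z; exact: dirichlet_simple.
apply: (@sub_countable _ _ _ (g @` [set z | (sol a z (0, 1) q.+1).1 = 0])); last first.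
  exact: card_le_trans (card_image_le _ _) cZ.
apply: subset_card_le => t [z [n [b [ab bq [h1 h2]]]]].
move: h1 h2; rewrite !(sol_perturb z _ ab bq) => h1 h2.
have e1 : (sol a z (1, 0) q.+1).1 = (-1) ^+ n := congr1 fst h1.
have e2 : (sol a z (1, 0) q.+1).2 + t * (sol a z (1, 0) q.+1).1 = 0 := congr1 snd h1.
exists z; first exact: (congr1 fst h2).
have s0 : (sol a z (1, 0) q.+1).1 != 0 by rewrite e1 signr_eq0.
by rewrite /g; apply: (mulIf s0); rewrite divfK//; move/eqP: e2; rewrite addrC addr_eq0 => /eqP.
Qed.
End Perturbation.

(** * Openness of the nonscalar condition *)

Section Topology.
Variable p : nat.
Local Notation P := (periodic_seq R p).
Local Notation couplings alpha := (fun k : nat => (alpha : P) k%:Z).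

Lemma eval_continuous (k : int) : continuous (fun alpha : P => alpha k).
Proof.
move=> alpha; have FF : Filter (nbhs alpha) by exact: nbhs_filter.
apply/cvgrPdist_lt => e e0.
have : \forall b \near alpha, ball alpha e b by exact: nbhsx_ballx.
apply: filterS => b; rewrite -ball_normE => ab.
by apply: le_lt_trans ab; exact: (linf_norm_ub (alpha - b) k).
Qed.

Lemma sol_jointly_continuous X k :
  continuous (fun q : R * P => (sol (couplings q.2) q.1 X k).1) /\
  continuous (fun q : R * P => (sol (couplings q.2) q.1 X k).2).
Proof.
elim: k => [|k [IH1 IH2]]; first by split => q; exact: cvg_cst.
have c1 : continuous (fun q : R * P => ccs q.1).
  move=> q; apply: (@continuous_comp _ _ _ fst (@ccs R)); first exact: cvg_fst.
  exact: is_derive_continuous (is_derive_ccs _).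
have c2 : continuous (fun q : R * P => scs q.1).
  move=> q; apply: (@continuous_comp _ _ _ fst (@scs R)); first exact: cvg_fst.
  exact: is_derive_continuous (is_derive_scs _).
have c3 : continuous (fun q : R * P => q.2 k%:Z).
  move=> q; apply: (@continuous_comp _ _ _ snd (fun alpha : P => alpha k%:Z)).
    exact: cvg_snd.
  exact: eval_continuous.
have c4 : continuous (fun q : R * P => q.1) by move=> q; exact: cvg_fst.
have s1 : continuous (fun q : R * P => (sol (couplings q.2) q.1 X k.+1).1).
  move=> q; apply: cvgD; apply: cvgM; [exact: c1|exact: IH1|exact: c2|exact: IH2].
split => // q; apply: cvgD; last by apply: cvgM; [exact: c3|exact: s1].
apply: cvgD; apply: cvgM; [|exact: IH1|exact: c1|exact: IH2].
by apply: cvgM; [apply: cvgN; exact: c4|exact: c2].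
Qed.

Lemma near_not_scalar k sg (q : R * P) :
  ~ monodromy_scalar (couplings q.2) k q.1 sg ->
  \forall q' \near q, ~ monodromy_scalar (couplings q'.2) k q'.1 sg.
Proof.
have [c1 c2] := sol_jointly_continuous (1, 0) k.
have [c3 c4] := sol_jointly_continuous (0, 1) k.
(* Scalar monodromy is the zero set of one continuous function, the squared distance of the transfer
   matrix from [sg] times the identity. *)
pose dist (q : R * P) :=
  ((sol (couplings q.2) q.1 (1, 0) k).1 - sg) ^+ 2 +
  (sol (couplings q.2) q.1 (1, 0) k).2 ^+ 2 +
  ((sol (couplings q.2) q.1 (0, 1) k).1 ^+ 2 +
  ((sol (couplings q.2) q.1 (0, 1) k).2 - sg) ^+ 2).
have cdist : continuous dist.
  move=> q'; apply: cvgD; apply: cvgD; apply: cvgM; solve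
    [exact: c2|exact: c3|apply: cvgB; [exact: c1|exact: cvg_cst]
    |apply: cvgB; [exact: c4|exact: cvg_cst]].
have distP q' : monodromy_scalar (couplings q'.2) k q'.1 sg <-> dist q' = 0.
  rewrite /monodromy_scalar /dist.
  split=> [[-> ->]|/eqP]; first by rewrite /= !subrr !expr0n/= !addr0.
  rewrite !paddr_eq0 ?addr_ge0 ?sqr_ge0// !sqrf_eq0 !subr_eq0.
  move=> /andP[/andP[/eqP h1 /eqP h2] /andP[/eqP h3 /eqP h4]].
  by split; rewrite [LHS]surjective_pairing ?h1 ?h2 ?h3 ?h4.
move=> nq; have d0 : dist q != 0 by apply/eqP => /distP.
by apply: filterS (cvgr_neq0 _ (cdist q) d0) => q' /eqP h /distP.
Qed.

Lemma Gdelta_not_scalar k : Gdelta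
  [set alpha : P | forall z (n : nat), ~ monodromy_scalar (couplings alpha) k z ((-1) ^+ n)].
Proof.
(* One open set for each compact energy window [[-n, n]]; the exponents 0 and 1 represent all signs
   [(-1)^n]. *)
pose A (n : nat) := [set alpha : P | forall z, z \in `[(- n%:R : R), n%:R] ->
  ~ monodromy_scalar (couplings alpha) k z 1 /\ ~ monodromy_scalar (couplings alpha) k z (-1)].
exists A.
  move=> n; rewrite openE => alpha hA; rewrite /interior.
  (* Compactness turns joint neighbourhoods of [(z, alpha)] into one neighbourhood of [alpha] that
     works for all [z] in the window. *)
  have := (compact_near_coveringP [set` `[(- n%:R : R), n%:R]]).1 (@segment_compact _ _ _).
  move=> /(_ P (nbhs alpha) (fun b z => ~ monodromy_scalar (couplings b) k z 1 /\
    ~ monodromy_scalar (couplings b) k z (-1))); apply => z /hA[h1 h2].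
  have := @near_not_scalar k 1 (z, alpha) h1; have := @near_not_scalar k (-1) (z, alpha) h2.
  by apply: filterS2 => -[z' b] /= ? ?; split.
apply/seteqP; split => [alpha h n _ z _|alpha h z n].
  by split; [exact: (h z 0%N)|exact: (h z 1%N)].
have zn : z \in `[(- (Num.truncn `|z|).+1%:R : R), (Num.truncn `|z|).+1%:R].
  by rewrite in_itv/= -ler_norml ltW// real_truncnS_gt ?num_real.
have [h1 h2] := h _ I z zn.
by rewrite -signr_odd; case: odd; rewrite ?expr0 ?expr1.
Qed.

End Topology.

(** The indicator of the sites congruent to [p - 1] modulo [p]: adding a multiple of it shifts only
    the last coupling of each period. *)
Definition comb (p : nat) (k : int) : R := ((p%:Z %| k + 1)%Z)%:R.

Lemma comb_periodic p : comb p \in @periodic_linf R p.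
Proof.
apply/asboolP; split.
  exists 1 => _ [k _ <-]; rewrite /comb; case: (_ %| _)%Z; rewrite ?normr1 ?normr0//.
move=> k; rewrite /comb addrAC; congr (nat_of_bool _)%:R.
by apply/dvdz_mod0P/dvdz_mod0P; rewrite modzDr.
Qed.

Definition comb_seq p : periodic_seq R p := PeriodicSeq (comb_periodic p).

Lemma comb_nat q k : (k <= q)%N -> comb q.+1 k%:Z = (k == q)%:R.
Proof.
move=> kq; rewrite /comb -PoszD addn1 dvdzE/= .
have [->|kq'] := eqVneq k q; first by rewrite dvdnn.
by rewrite gtnNdvd// ltnS ltn_neqAle kq' kq.
Qed.

Lemma dense_not_scalar p : (0 < p)%N -> dense [set alpha : periodic_seq R p |
  forall z (n : nat), ~ monodromy_scalar (fun k : nat => alpha k%:Z) p z ((-1) ^+ n)].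
Proof.
case: p => // q _ O [alpha Oa] oO.
have : nbhs alpha O by move: oO; rewrite openE => /(_ alpha Oa).
move=> /nbhs_ballP[e /= e0 he].
pose bad := [set t | exists z (n : nat) b, [/\ forall i, (i < q)%N -> b i = alpha i%:Z,
    b q = alpha q%:Z + t & monodromy_scalar b q.+1 z ((-1) ^+ n)]].
have cb : countable bad := countable_scalar_perturbations (fun k : nat => alpha k%:Z) q.
(* The interval has positive measure and the bad parameters are countable, hence null. *)
have [t /andP[t0 te] tb] : exists2 t, 0 < t < e & ~ bad t.
  apply: contrapT => nt.
  have sub : `]0, e[ `<=` bad.
    move=> t; rewrite /= in_itv/= => te; apply: contrapT => tb.
    by apply: nt; exists t.
  have : (mu `]0%R, e[ <= mu bad)%E.
    apply: le_measure => //; apply: mem_set; first exact: measurable_itv.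
    by apply: countable_measurable cb => t; exact: measurable_set1.
  rewrite lebesgue_measure_itv/= (countable_lebesgue_measure0 cb) lte_fin e0.
  by rewrite -EFinB lee_fin subr0 leNgt e0.
exists (alpha + t *: comb_seq q.+1); split.
  (* The comb has sup norm at most 1, so a shift by [t < e] stays in the ball. *)
  apply: he; rewrite -ball_normE /ball_/= opprD addNKr normrN normrZ gtr0_norm//.
  rewrite (le_lt_trans _ te)// ler_piMr ?(ltW t0)//.
  apply: linf_norm_le => k /=; rewrite /comb.
  by case: (_ %| _)%Z; rewrite ?normr1 ?normr0.
move=> z n h; apply: tb; exists z, n; eexists; split; last exact: h.
- move=> i iq; transitivity (alpha i%:Z + t * comb q.+1 i%:Z); first by [].
  by rewrite comb_nat ?(ltnW iq)// ltn_eqF// mulr0 addr0.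
- transitivity (alpha q%:Z + t * comb q.+1 q%:Z); first by [].
  by rewrite comb_nat// eqxx mulr1.
Qed.
End Generic.

Theorem theorem4p17 (R : realType) (p : nat) (hp : (0 < p)%N) :
  exists S : set (periodic_seq R p),
    [/\ dense S, Gdelta S & forall alpha, S alpha -> all_gaps_open alpha].
Proof.
exists [set alpha : periodic_seq R p | forall z (n : nat),
  ~ monodromy_scalar (fun k : nat => alpha k%:Z) p z ((-1) ^+ n)].
split; [exact: dense_not_scalar|exact: Gdelta_not_scalar|].
by move=> alpha; exact: all_gaps_open_monodromy.
Qed.
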